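(* Let $\xi\in\mathfrak{g}_2$ and let $(H_\xi,X_\xi)$, with $H_\xi\in\Omega^1(\mathbb{S}^6)$, be a solution of the Hamilton-de Donder-Weyl equation in dimension one on $(\mathbb{S}^6,\omega)$, i.e. $\iota_{X_\xi}\omega=dH_\xi$. Then for every $p\in\mathbb{S}^6$ the map $$\psi^\xi_p:\mathbb{R}\to\mathbb{S}^6,\quad t\mapsto e^{t\xi}\cdot p$$ is a solution of the dynamical Hamilton-de Donder-Weyl equation, i.e. for all $t\in\mathbb{R}$ $$\iota_{(\psi^\xi_p)_*\left(\frac{\partial}{\partial t}|_t\right)}\,\omega_{\psi^\xi_p(t)}=(dH_\xi)_{\psi^\xi_p(t)}.$$ The image of a solution $\psi:\mathbb{R}\to\mathbb{S}^6$ of this dynamical equation is thus the image of an integral curve of a fundamental vector field of the $G_2$-action. If $X_\xi(p)=0$, the image of $\psi_p^\xi$ is a point; otherwise it is an injectively immersed copy of $\mathbb{R}/Stab_p(\mathbb{R})$, where $Stab_p(\mathbb{R})=\{t\in\mathbb{R}\mid e^{t\xi}\cdot p=p\}$, and is either diffeomorphic to $\mathbb{S}^1$ or to $\mathbb{R}$. In the latter case, the closure of the orbit $\psi_p^\xi(\mathbb{R})$ is diffeomorphic to $\mathbb{S}^1\times\mathbb{S}^1$.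
   Context: The octonions $\mathbb{O}$ are the real algebra with vector space basis $e_0,e_1,\dots,e_7$, unit $e_0=1$, and products $e_ie_j=-\delta_{ij}+\sum_{k=1}^7\epsilon_{ijk}e_k$ for $i,j\in\{1,\dots,7\}$, where $\epsilon_{ijk}$ is completely antisymmetric, equal to $1$ for $ijk=123,145,167,246,275,374,365$, and $0$ whenever $(i,j,k)$ is not a permutation of one of these triples. The imaginary octonions (span of $e_1,\dots,e_7$) are identified with $\mathbb{R}^7$ with its standard scalar product $\langle\cdot,\cdot\rangle$. The cross product on $\mathbb{R}^7$ is $u\times v:=\frac12(u\cdot v-v\cdot u)$. The constant-coefficient $3$-form $\widetilde\omega$ on $\mathbb{R}^7$ is $\widetilde\omega(u,v,w)=\langle u\times v,w\rangle$. Let $j:\mathbb{S}^6\hookrightarrow\mathbb{R}^7$ be the inclusion of the unit sphere and $\omega:=j^*\widetilde\omega\in\Omega^3(\mathbb{S}^6)$. $G_2\subset GL(7,\mathbb{R})$ is the image of the group of $\mathbb{R}$-algebra automorphisms of $\mathbb{O}$ under restriction to the imaginary octonions $\mathbb{R}^7$; it is a closed subgroup of $SO(7,\mathbb{R})$ and acts on $\mathbb{S}^6$. Its Lie algebra is $\mathfrak{g}_2$, and $X_\xi$ denotes the fundamental vector field on $\mathbb{S}^6$ of $\xi\in\mathfrak{g}_2$, with the convention $X_\xi(p)=\frac{d}{dt}\big|_{t=0}e^{t\xi}\cdot p$. *)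

(* Defs.v *)
From HB Require Import structures.
From mathcomp Require Import all_boot all_order all_algebra.
From mathcomp Require Import all_classical all_reals all_analysis.

Import Order.TTheory GRing.Theory Num.Theory.
Import numFieldNormedType.Exports.
Local Open Scope classical_set_scope.
Local Open Scope ring_scope.

(** * Smooth maps between finite-dimensional real vector spaces *)

(** [f] is C^k on the open set [U]: all iterated directional derivatives of
    order at most [k] exist and are continuous on [U]. *)
Fixpoint Ck {R : realType} {V W : normedModType R}
    (k : nat) (U : set V) (f : V -> W) : Prop :=
  if k is k'.+1 then
    (forall x, U x -> {for x, continuous f}) /\
    (forall v, (forall x, U x -> derivable f x v) /\ Ck k' U (fun x => 'D_v f x))
  else forall x, U x -> {for x, continuous f}.

Definition Cinfty {R : realType} {V W : normedModType R}
    (U : set V) (f : V -> W) : Prop := forall k, Ck k U f.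

(** A map on an arbitrary subset [A] is smooth when it extends smoothly to an
    open neighbourhood of each point of [A]; for [A] an embedded submanifold this
    is smoothness in the sense of manifolds. *)
Definition smooth_on {R : realType} {V W : normedModType R}
    (A : set V) (f : V -> W) : Prop :=
  forall x, A x -> exists (U : set V) (F : V -> W),
    [/\ open U, U x, Cinfty U F & forall y, A y -> U y -> F y = f y].

Definition diffeomorphic {R : realType} {V W : normedModType R}
    (A : set V) (B : set W) : Prop :=
  exists (f : V -> W) (g : W -> V),
    [/\ smooth_on A f, smooth_on B g,
        (forall x, A x -> B (f x) /\ g (f x) = x) &
        (forall y, B y -> A (g y) /\ f (g y) = y)].

(** * The quotient manifold R/S

    For a closed subgroup [S] of the real line, R/S is the set of cosets
    [range (real_coset S)], with the unique smooth structure making the projection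
    [real_coset S] a submersion.  Hence a map out of R/S is smooth iff its composite
    with [real_coset S] is, and a map into R/S is smooth iff it locally lifts to a
    smooth real-valued function. *)
Definition real_coset {R : realType} (S : set R) (t : R) : set R :=
  [set t + s | s in S].

Definition quot_smooth {R : realType} {W : normedModType R}
    (S : set R) (F : set R -> W) : Prop :=
  Cinfty [set: R] (fun t => F (real_coset S t)).

Definition quot_diffeomorphic {R : realType} {W : normedModType R}
    (S : set R) (B : set W) : Prop :=
  exists F : set R -> W,
    [/\ set_bij (range (real_coset S)) B F,
        quot_smooth S F &
        forall b, B b -> exists (U : set W) (lift : W -> R),
          [/\ open U, U b, Cinfty U lift &
              forall y, B y -> U y -> F (real_coset S (lift y)) = y]].

(** Injective immersion of the one-dimensional manifold R/S ([S] discrete, so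
    that [real_coset S] is a local diffeomorphism and the differential of [F] is
    that of its composite with [real_coset S]); discreteness of [S] is in fact
    forced by the nonvanishing of the derivative. *)
Definition quot_injective_immersion {R : realType} {W : normedModType R}
    (S : set R) (F : set R -> W) : Prop :=
  [/\ quot_smooth S F,
      set_inj (range (real_coset S)) F &
      forall t : R, 'D_1 (fun s : R => F (real_coset S s)) t != 0].

(** * Octonions, cross product, G_2 *)

Definition dot {R : realType} {n : nat} (u v : 'cV[R]_n) : R :=
  \sum_(i < n) u i 0 * v i 0.

Definition fano : seq (nat * nat * nat) :=
  [:: (1, 2, 3); (1, 4, 5); (1, 6, 7); (2, 4, 6); (2, 7, 5); (3, 7, 4);
      (3, 6, 5)]%N.

Definition fano_cyclic (i j k : nat) : bool :=
  [|| (i, j, k) \in fano, (j, k, i) \in fano | (k, i, j) \in fano].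

Definition epsilon (R : realType) (i j k : nat) : R :=
  if fano_cyclic i j k then 1 else if fano_cyclic j i k then -1 else 0.

(** The coefficient of e_k in the product e_i e_j. *)
Definition ostruct (R : realType) (i j k : 'I_8) : R :=
  if i == 0 :> nat then (j == k)%:R
  else if j == 0 :> nat then (i == k)%:R
  else if k == 0 :> nat then - (i == j)%:R
  else epsilon R i j k.

Definition octonion (R : realType) := 'cV[R]_8.

Definition omul {R : realType} (x y : octonion R) : octonion R :=
  \col_k \sum_i \sum_j x i 0 * y j 0 * ostruct R i j k.

Definition oone (R : realType) : octonion R := delta_mx 0 0.

Definition oimag {R : realType} (u : 'cV[R]_7) : octonion R :=
  col_mx (0 : 'cV_1) u.

(** The imaginary part; it loses nothing on u v - v u, whose real part is 0. *)
Definition ovec {R : realType} (x : octonion R) : 'cV[R]_7 :=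
  dsubmx (x : 'cV_(1 + 7)).

Definition cross {R : realType} (u v : 'cV[R]_7) : 'cV[R]_7 :=
  ovec (2^-1 *: (omul (oimag u) (oimag v) - omul (oimag v) (oimag u))).

Definition oct_automorphism {R : realType}
    (phi : {linear octonion R -> octonion R}) : Prop :=
  [/\ bijective phi, phi (oone R) = oone R &
      forall x y, phi (omul x y) = omul (phi x) (phi y)].

Definition G2 (R : realType) : set 'M[R]_7 :=
  [set g | exists phi : {linear octonion R -> octonion R},
     oct_automorphism phi /\ forall u, phi (oimag u) = oimag (g *m u)].

Definition mexp {R : realType} (A : 'M[R]_7) : 'M[R]_7 :=
  limn (series (fun k : nat => (k`!%:R)^-1 *: A ^+ k)).

Definition g2 (R : realType) : set 'M[R]_7 :=
  [set xi | forall t : R, G2 R (mexp (t *: xi))].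

(** * Forms on the six-sphere

    A form on the sphere is given by a function of a point and of vectors of the
    ambient space; only its values at points of the sphere and on tangent
    vectors are meaningful. *)

Definition S6 (R : realType) : set 'cV[R]_7 := [set p | dot p p = 1].

Definition tangent {R : realType} (p : 'cV[R]_7) : set 'cV[R]_7 :=
  [set v | dot p v = 0].

Definition omega_tilde {R : realType} (u v w : 'cV[R]_7) : R :=
  dot (cross u v) w.

(** The pullback of [omega_tilde] to the sphere at the point [p]: the base point
    only matters through the tangent vectors to which the form is applied. *)
Definition omega {R : realType} (p u v w : 'cV[R]_7) : R := omega_tilde u v w.

Definition retraction {R : realType} (x : 'cV[R]_7) : 'cV[R]_7 :=
  (Num.sqrt (dot x x))^-1 *: x.

(** The pullback of a one-form [H] on the sphere by [retraction], a one-form on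
    the complement of the origin. *)
Definition radial_ext {R : realType} (H : 'cV[R]_7 -> 'cV[R]_7 -> R)
    (x v : 'cV[R]_7) : R :=
  H (retraction x) ('D_v retraction x).

(** Smooth one-forms on the sphere.  As [retraction] is a smooth retraction of
    the complement of the origin onto the sphere, [H] is smooth iff its pullback
    is, i.e. iff the latter has smooth coefficients. *)
Definition one_form {R : realType} (H : 'cV[R]_7 -> 'cV[R]_7 -> R) : Prop :=
  (forall p, S6 R p -> forall (a : R) u v, tangent p u -> tangent p v ->
     H p (a *: u + v) = a * H p u + H p v) /\
  (forall v, Cinfty [set x | x != 0] (fun x => radial_ext H x v : R)).

(** Exterior derivative of a one-form on an open subset of R^7. *)
Definition ext_deriv {R : realType} (alpha : 'cV[R]_7 -> 'cV[R]_7 -> R)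
    (x u v : 'cV[R]_7) : R :=
  'D_u (fun y => alpha y v : R) x - 'D_v (fun y => alpha y u : R) x.

(** Exterior derivative on the sphere: with j the inclusion and r the retraction,
    dH = j^* d(r^* H) because r o j is the identity. *)
Definition dS6 {R : realType} (H : 'cV[R]_7 -> 'cV[R]_7 -> R)
    (p u v : 'cV[R]_7) : R :=
  ext_deriv (radial_ext H) p u v.

(** * Hamilton-de Donder-Weyl equations *)

Definition flow {R : realType} (xi : 'M[R]_7) (p : 'cV[R]_7) (t : R) : 'cV[R]_7 :=
  mexp (t *: xi) *m p.

Definition fundvf {R : realType} (xi : 'M[R]_7) (p : 'cV[R]_7) : 'cV[R]_7 :=
  'D_1 (flow xi p) (0 : R).

(** Equality at the point [p] of the two-form i_X omega, for [X] tangent to the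
    sphere at [p], with dH. *)
Definition HDW_at {R : realType} (H : 'cV[R]_7 -> 'cV[R]_7 -> R)
    (p X : 'cV[R]_7) : Prop :=
  forall v w, tangent p v -> tangent p w -> omega p X v w = dS6 H p v w.

Definition HDW {R : realType} (H : 'cV[R]_7 -> 'cV[R]_7 -> R)
    (X : 'cV[R]_7 -> 'cV[R]_7) : Prop :=
  forall p, S6 R p -> HDW_at H p (X p).

Definition smooth_curve {R : realType} (psi : R -> 'cV[R]_7) : Prop :=
  Cinfty [set: R] psi /\ forall t, S6 R (psi t).

Definition dynamical_HDW {R : realType} (H : 'cV[R]_7 -> 'cV[R]_7 -> R)
    (psi : R -> 'cV[R]_7) : Prop :=
  smooth_curve psi /\ forall t : R, HDW_at H (psi t) ('D_1 psi t).

Definition integral_curve {R : realType} (X : 'cV[R]_7 -> 'cV[R]_7)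
    (gamma : R -> 'cV[R]_7) : Prop :=
  smooth_curve gamma /\ forall t : R, 'D_1 gamma t = X (gamma t).

Definition stab {R : realType} (xi : 'M[R]_7) (p : 'cV[R]_7) : set R :=
  [set t | flow xi p t = p].

Definition circle (R : realType) : set 'cV[R]_2 := [set z | dot z z = 1].

(* Main.v *)
From HB Require Import structures.
Require Import Defs.
From mathcomp Require Import all_boot all_order all_algebra.
From mathcomp Require Import all_classical all_reals all_analysis.
From mathcomp Require Import ring lra.
Import Order.TTheory GRing.Theory Num.Theory.
Import numFieldNormedType.Exports.
Local Open Scope classical_set_scope.
Local Open Scope ring_scope.

Set Implicit Arguments.
Unset Strict Implicit.
Unset Printing Implicit Defensive.

(** Two facts about an element xi of g_2 carry the theorem. Differentiating at
    t = 0 the invariance of the scalar product and of the cross product under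
    exp (t xi) shows that xi is skew and is a derivation of the cross product
    ([g2_skew], [g2_derivation]). Skewness makes norms constant along the solutions
    of x' = xi x, so a solution is determined by its initial value
    ([skew_solves_unique]), and the flow of xi is known as soon as an explicit
    solution is exhibited.

    The Hamilton-de Donder-Weyl equation at a point p of the sphere determines the
    vector that is contracted with omega: a tangent vector u with <u x v, w> = 0
    for all tangent v and w vanishes ([cross_nondegenerate]). Since X_xi satisfies
    the equation everywhere, a curve on the sphere is a solution of the dynamical
    equation iff it is an integral curve of X_xi.

    For the orbits, xi kills a unit vector e, being skew of odd size. The operator
    e x is a complex structure on the orthogonal of e that commutes with xi, and xi
    acts on this C^3 as an element of su(3): it is diagonal in a unitary basis of
    the form u, v, u x v, with rates of sum zero ([unitary_frame]). Hence
<<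
    exp (t xi) p = p0 + \sum_(i < 3) (cos (a_i t) A_i + sin (a_i t) B_i)
>>
    for vectors spanning mutually orthogonal planes, with |A_i| = |B_i| and rates
    a_i of sum zero ([flow_torus_orbit]). If X_xi (p) is not zero, some A_i and its
    rate a_i are not zero, and the stabilizer of p is T Z for some T >= 0
    ([period_cyclic]). The quotient is a circle if T > 0 and a line if T = 0; it is
    not a line if T > 0, because a continuous periodic function is bounded.

    If T = 0, two of the A_i are not zero, since a single rotation is periodic
    ([two_planes]). The corresponding pair of angles is an injective linear flow on
    the two-dimensional torus, which is dense by Kronecker's theorem ([kronecker]).
    The third plane turns by the conjugate of the product of the two others, so
    that the closure of the orbit is the image of the torus under a polynomial map,
    and two pairs of linear coordinates invert this map ([closure_torus_orbit],
    [torus_coordK]). *)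

(** * The cross product in coordinates *)

Section Cross.
Variable R : realType.
Implicit Types u v w : 'cV[R]_7.

Lemma oimag0 u : oimag u 0 0 = 0.
Proof. by rewrite /oimag mxE; case: splitP => // j; rewrite mxE. Qed.

Lemma oimagS u (i : 'I_7) : oimag u (lift ord0 i) 0 = u i 0.
Proof.
rewrite /oimag (_ : lift ord0 i = rshift 1 i); last exact/val_inj.
by rewrite (@col_mxEd _ 1 7).
Qed.

Lemma omul_imagS u v (k : 'I_7) : omul (oimag u) (oimag v) (lift ord0 k) 0 =
  \sum_(i < 7) \sum_(j < 7) u i 0 * v j 0 * epsilon R i.+1 j.+1 k.+1.
Proof.
rewrite mxE big_ord_recl [X in X + _]big1 ?add0r => [|j _].
  apply: eq_bigr => i _; rewrite big_ord_recl oimag0 mulr0 mul0r add0r.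
  by apply: eq_bigr => j _; rewrite !oimagS.
by rewrite oimag0 !mul0r.
Qed.

Lemma omul_imag0 u v : omul (oimag u) (oimag v) 0 0 = - dot u v.
Proof.
rewrite mxE big_ord_recl [X in X + _]big1 ?add0r => [|j _]; last first.
  by rewrite oimag0 !mul0r.
rewrite /dot -sumrN; apply: eq_bigr => i _.
rewrite big_ord_recl oimag0 oimagS !(mulr0, mul0r) add0r (bigD1 i)//= big1 ?addr0 => [|j ji].
  by rewrite !oimagS /ostruct /= eqxx mulrN1.
by rewrite !oimagS /ostruct /= (inj_eq lift_inj) eq_sym (negPf ji) oppr0 mulr0.
Qed.

Lemma epsilonC (i j k : nat) : (0 < i < 8)%N -> (0 < j < 8)%N ->
  (0 < k < 8)%N -> epsilon R j i k = - epsilon R i j k.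
Proof.
move=> hi hj hk.
have H : all (fun i => all (fun j => all (fun k =>
    ~~ (fano_cyclic i j k && fano_cyclic j i k)) (iota 1 7)) (iota 1 7)) (iota 1 7).
  by vm_compute.
have mem n : (0 < n < 8)%N -> n \in iota 1 7 by rewrite mem_iota.
move/allP : H => /(_ i (mem _ hi)) /allP/(_ j (mem _ hj)) /allP/(_ k (mem _ hk)).
rewrite /epsilon.
by case: (fano_cyclic i j k); case: (fano_cyclic j i k) => //=; rewrite ?opprK ?oppr0.
Qed.

Lemma cross_sum u v (k : 'I_7) : cross u v k 0 =
  \sum_(i < 7) \sum_(j < 7) u i 0 * v j 0 * epsilon R i.+1 j.+1 k.+1.
Proof.
rewrite /cross /ovec mxE.
rewrite (_ : rshift 1 k = lift ord0 k); last exact/val_inj.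
rewrite mxE [X in _ * X]mxE [X in _ + X]mxE !omul_imagS.
set s := (X in _ = X).
suff -> : \sum_(i < 7) \sum_(j < 7) v i 0 * u j 0 * epsilon R i.+1 j.+1 k.+1 = - s.
  by rewrite -/s; lra.
rewrite /s exchange_big -sumrN; apply: eq_bigr => i _.
rewrite -sumrN; apply: eq_bigr => j _.
have lt8 (l : 'I_7) : (0 < l.+1 < 8)%N by case: l.
by rewrite (epsilonC (lt8 i) (lt8 j) (lt8 k)) mulrN [v j 0 * _]mulrC.
Qed.

Definition cross_coords (x y : nat -> R) : seq R :=
 [:: x 1%N * y 2%N - x 2%N * y 1%N + (x 3%N * y 4%N - x 4%N * y 3%N)
       + (x 5%N * y 6%N - x 6%N * y 5%N);
     x 2%N * y 0%N - x 0%N * y 2%N + (x 3%N * y 5%N - x 5%N * y 3%N)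
       + (x 6%N * y 4%N - x 4%N * y 6%N);
     x 0%N * y 1%N - x 1%N * y 0%N + (x 6%N * y 3%N - x 3%N * y 6%N)
       + (x 5%N * y 4%N - x 4%N * y 5%N);
     x 4%N * y 0%N - x 0%N * y 4%N + (x 5%N * y 1%N - x 1%N * y 5%N)
       + (x 2%N * y 6%N - x 6%N * y 2%N);
     x 0%N * y 3%N - x 3%N * y 0%N + (x 1%N * y 6%N - x 6%N * y 1%N)
       + (x 2%N * y 5%N - x 5%N * y 2%N);
     x 6%N * y 0%N - x 0%N * y 6%N + (x 1%N * y 3%N - x 3%N * y 1%N)
       + (x 4%N * y 2%N - x 2%N * y 4%N);
     x 0%N * y 5%N - x 5%N * y 0%N + (x 4%N * y 1%N - x 1%N * y 4%N)
       + (x 3%N * y 2%N - x 2%N * y 3%N)].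

(** Indexing coordinates by natural numbers unfolds the sums over ['I_7] into
    polynomials in uniform atoms. *)
Definition coord u n : R := u (inord n) 0.

Lemma sum7 (f : nat -> R) :
  \sum_(i < 7) f i = f 0%N + f 1%N + f 2%N + f 3%N + f 4%N + f 5%N + f 6%N.
Proof. by rewrite !big_ord_recr big_ord0 /= add0r. Qed.

Lemma coordE u (i : 'I_7) : u i 0 = coord u i.
Proof. by rewrite /coord inord_val. Qed.

Lemma crossE u v (k : 'I_7) :
  cross u v k 0 = nth 0 (cross_coords (coord u) (coord v)) k.
Proof.
rewrite cross_sum.
under eq_bigr do under eq_bigr do rewrite !coordE.
move: (coord u) (coord v) => x y.
pose F (i j : nat) := x i * y j * epsilon R i.+1 j.+1 k.+1.
rewrite (sum7 (fun i => \sum_(j < 7) F i j)) !(sum7 (F _)) /F.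
case: k {F} => -[|[|[|[|[|[|[|//]]]]]]] ? /=; rewrite /epsilon /=; ring.
Qed.

Lemma dotE u v : dot u v = coord u 0 * coord v 0 + coord u 1 * coord v 1 +
  coord u 2 * coord v 2 + coord u 3 * coord v 3 + coord u 4 * coord v 4 +
  coord u 5 * coord v 5 + coord u 6 * coord v 6.
Proof.
rewrite /dot; under eq_bigr do rewrite !coordE.
by rewrite (sum7 (fun i => coord u i * coord v i)).
Qed.

Lemma coord_cross u v n : (n < 7)%N ->
  coord (cross u v) n = nth 0 (cross_coords (coord u) (coord v)) n.
Proof. by move=> n7; rewrite {1}/coord crossE inordK. Qed.

Lemma cross_dot_alt u v w : dot (cross u v) w = dot u (cross v w).
Proof. rewrite !dotE !coord_cross //=; ring. Qed.

Lemma crossC u v : cross v u = - cross u v.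
Proof.
apply/colP => k; rewrite [RHS]mxE !crossE.
case: k => -[|[|[|[|[|[|[|//]]]]]]] ? /=; ring.
Qed.

(** Polarization of u x (u x w) = <u, w> u - <u, u> w, the form that the
    alternativity of the octonions takes for the cross product. *)
Lemma cross_cross u v w : cross u (cross v w) + cross v (cross u w) =
  dot u w *: v + dot v w *: u - (2 * dot u v) *: w.
Proof.
apply/colP => k; rewrite [LHS]mxE !crossE [RHS]mxE.
rewrite [X in _ = X + _]mxE [X in _ = X + _ + _]mxE [X in _ = _ + X + _]mxE.
rewrite [X in _ = _ + X]mxE [X in _ = _ - X]mxE !dotE !coordE.
case: k => -[|[|[|[|[|[|[|//]]]]]]] ? /=; rewrite !coord_cross //=; ring.
Qed.

End Cross.

(** * Scalar product and cross product *)

Section Dot.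
Variables (R : realType) (n : nat).
Implicit Types u v w : 'cV[R]_n.

Lemma dotC u v : dot u v = dot v u.
Proof. by apply: eq_bigr => i _; rewrite mulrC. Qed.

Lemma dotDl u v w : dot (u + v) w = dot u w + dot v w.
Proof. by rewrite /dot -big_split; apply: eq_bigr => i _; rewrite mxE mulrDl. Qed.

Lemma dotZl a u v : dot (a *: u) v = a * dot u v.
Proof. by rewrite /dot mulr_sumr; apply: eq_bigr => i _; rewrite mxE mulrA. Qed.

Lemma dotDr u v w : dot w (u + v) = dot w u + dot w v.
Proof. by rewrite dotC dotDl !(dotC w). Qed.

Lemma dotZr a u v : dot u (a *: v) = a * dot u v.
Proof. by rewrite dotC dotZl dotC. Qed.

Lemma dotNl u v : dot (- u) v = - dot u v.
Proof. by rewrite -scaleN1r dotZl mulN1r. Qed.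

Lemma dotNr u v : dot u (- v) = - dot u v.
Proof. by rewrite dotC dotNl dotC. Qed.

Lemma dot0l u : dot 0 u = 0.
Proof. by rewrite -(scale0r u) dotZl mul0r. Qed.

Lemma dot0r u : dot u 0 = 0.
Proof. by rewrite dotC dot0l. Qed.

Definition dot_lin := (dotDl, dotDr, dotZl, dotZr, dotNl, dotNr, dot0l, dot0r).

Lemma dot_sumr I (r : seq I) (P : pred I) (F : I -> 'cV[R]_n) u :
  dot u (\sum_(i <- r | P i) F i) = \sum_(i <- r | P i) dot u (F i).
Proof.
by elim/big_rec2 : _ => [|i x y _ <-]; rewrite ?dot0r// dotDr.
Qed.

Lemma dot_ge0 u : 0 <= dot u u.
Proof. by apply: sumr_ge0 => i _; rewrite -expr2 sqr_ge0. Qed.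

Lemma dot_eq0 u : dot u u = 0 -> u = 0.
Proof.
move=> u0; apply/colP => i; rewrite mxE; apply/eqP; rewrite -sqrf_eq0 expr2.
move: u0 => /eqP; rewrite psumr_eq0 => [/allP/(_ i)|j _]; last by rewrite -expr2 sqr_ge0.
by rewrite mem_index_enum => /(_ isT).
Qed.

Lemma dot_gt0 u : u != 0 -> 0 < dot u u.
Proof.
by move=> u0; rewrite lt_neqAle dot_ge0 andbT eq_sym; apply: contra u0 => /eqP/dot_eq0 ->.
Qed.

Lemma exists_unit_multiple u : u != 0 -> exists c, dot (c *: u) (c *: u) = 1.
Proof.
move=> u0; exists (Num.sqrt (dot u u))^-1.
rewrite dotZl dotZr mulrA -invfM -expr2 sqr_sqrtr ?dot_ge0// mulVf//.
by rewrite gt_eqF// dot_gt0.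
Qed.

Lemma dot_delta u k : dot u (delta_mx k 0) = u k 0.
Proof.
rewrite /dot (bigD1 k)//= big1 ?addr0 => [|i ik]; last first.
  by rewrite mxE (negPf ik) mulr0.
by rewrite mxE !eqxx mulr1.
Qed.

Lemma entry_dot (A : 'M[R]_n) k l : A k l = dot (A *m delta_mx l 0) (delta_mx k 0).
Proof. by rewrite dot_delta -colE mxE. Qed.

Lemma dot_trmx (A : 'M[R]_n) u v : dot (A *m u) v = dot u (A^T *m v).
Proof.
have dotE (x y : 'cV[R]_n) : dot x y = (x^T *m y) 0 0.
  by rewrite mxE; apply: eq_bigr => i _; rewrite mxE.
by rewrite !dotE trmx_mul mulmxA.
Qed.

(** Fewer vectors than the dimension form the columns of a matrix with a
    nontrivial left kernel. *)
Lemma exists_orthogonal (s : seq 'cV[R]_n) : (size s < n)%N ->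
  exists2 x, x != 0 & forall a, a \in s -> dot a x = 0.
Proof.
move=> sn; pose N := \matrix_(i < n, j < size s) s`_j i 0.
have kN : kermx N != 0.
  by rewrite kermx_eq0 /row_free neq_ltn (leq_ltn_trans (rank_leq_col N)).
exists (nz_row (kermx N))^T.
  by rewrite -trmx0 (inj_eq trmx_inj) nz_row_eq0.
move=> a /(nthP 0)[j js <-].
have /sub_kermxP /rowP/(_ (Ordinal js)) := nz_row_sub (kermx N).
rewrite !mxE => H; rewrite -[RHS]H; apply: eq_bigr => i _.
by rewrite !mxE mulrC.
Qed.

(** The orthonormal vectors f i are the columns of a matrix Q with Q^T Q = 1,
    hence Q Q^T = 1. *)
Lemma orthonormal_expansion (f : 'I_n -> 'cV[R]_n) x :
  (forall i j, dot (f i) (f j) = (i == j)%:R) -> x = \sum_i dot (f i) x *: f i.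
Proof.
move=> fo; pose Q := \matrix_(i < n, j < n) f j i 0.
have QQ : Q *m Q^T = 1%:M.
  apply: mulmx1C; apply/matrixP => i j; rewrite !mxE -fo.
  by apply: eq_bigr => k _; rewrite !mxE.
rewrite -[LHS]mul1mx -QQ -mulmxA; apply/colP => k; rewrite mxE summxE.
apply: eq_bigr => i _; rewrite !mxE mulrC; congr (_ * _).
by apply: eq_bigr => l _; rewrite !mxE.
Qed.

End Dot.

Section CrossTheory.
Variable R : realType.
Implicit Types e p u v w : 'cV[R]_7.

Lemma crossDr u v w : cross u (v + w) = cross u v + cross u w.
Proof.
apply/colP => k; rewrite [RHS]mxE !cross_sum -big_split; apply: eq_bigr => i _.
by rewrite -big_split; apply: eq_bigr => j _; rewrite mxE mulrDr mulrDl.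
Qed.

Lemma crossZr a u v : cross u (a *: v) = a *: cross u v.
Proof.
apply/colP => k; rewrite [RHS]mxE !cross_sum mulr_sumr; apply: eq_bigr => i _.
by rewrite mulr_sumr; apply: eq_bigr => j _; rewrite mxE mulrCA !mulrA.
Qed.

Lemma crossDl u v w : cross (v + w) u = cross v u + cross w u.
Proof. by rewrite crossC crossDr opprD -!crossC. Qed.

Lemma crossZl a u v : cross (a *: v) u = a *: cross v u.
Proof. by rewrite crossC crossZr -scalerN -crossC. Qed.

Lemma crossNr u v : cross u (- v) = - cross u v.
Proof. by rewrite -scaleN1r crossZr scaleN1r. Qed.

Lemma crossvv u : cross u u = 0.
Proof.
apply/colP => k; have /colP/(_ k) := crossC u u.
by rewrite [RHS]mxE => E; rewrite [RHS]mxE; lra.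
Qed.

Lemma dot_crossl u v : dot u (cross u v) = 0.
Proof. by rewrite -cross_dot_alt crossvv dot0l. Qed.

Lemma dot_crossr u v : dot v (cross u v) = 0.
Proof. by rewrite crossC dotNr dot_crossl oppr0. Qed.

Lemma cross_cross_same u w : cross u (cross u w) = dot u w *: u - dot u u *: w.
Proof.
apply/colP => k; have /colP/(_ k) := cross_cross u u w.
move: (cross u (cross u w)) => x; rewrite !mxE.
by move: (dot u w) (dot u u) (x k 0) (u k 0) (w k 0) => a b c d f; lra.
Qed.

Lemma cross_norm u v :
  dot (cross u v) (cross u v) = dot u u * dot v v - dot u v ^+ 2.
Proof.
rewrite cross_dot_alt (crossC v u) crossNr cross_cross_same opprB !dot_lin.
rewrite (dotC v u); ring.
Qed.

(** For a nonzero v orthogonal to p, u and p x u, the vector u x v is tangent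
    at p, so the hypothesis applies to w = u x v and gives |u| |v| = 0. *)
Lemma cross_nondegenerate p u : dot p u = 0 ->
  (forall v w, dot p v = 0 -> dot p w = 0 -> dot (cross u v) w = 0) -> u = 0.
Proof.
move=> pu H.
have [v v0 Hv] := @exists_orthogonal R 7 [:: p; u; cross p u] isT.
have pv : dot p v = 0 by apply: Hv; rewrite !inE eqxx.
have uv : dot u v = 0 by apply: Hv; rewrite !inE eqxx orbT.
have puv : dot p (cross u v) = 0.
  by rewrite -cross_dot_alt; apply: Hv; rewrite !inE eqxx !orbT.
have := H _ _ pv puv; rewrite cross_norm uv expr0n subr0 => /eqP.
by rewrite mulf_eq0 (gt_eqF (dot_gt0 v0)) orbF => /eqP/dot_eq0.
Qed.

Lemma cross_mulmx u : exists M : 'M[R]_7, forall v, cross u v = M *m v.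
Proof.
exists (\matrix_(k, j) \sum_(i < 7) u i 0 * epsilon R i.+1 j.+1 k.+1) => v.
apply/colP => k; rewrite cross_sum mxE exchange_big; apply: eq_bigr => j _.
by rewrite mxE mulr_suml; apply: eq_bigr => i _; rewrite mulrAC.
Qed.

(** The operator e x, for a unit vector e, is an isometry on the orthogonal of e;
    as it squares to -1 there, it turns this space into a hermitian C^3. *)
Lemma dot_cross_cross e u v : dot e e = 1 -> dot e u = 0 ->
  dot (cross e u) (cross e v) = dot u v.
Proof.
move=> ee eu; rewrite crossC dotNl cross_dot_alt cross_cross_same ee !dot_lin.
by rewrite (dotC u) eu; ring.
Qed.

Lemma dot_cross_swap e u v : dot u (cross e v) = - dot (cross e u) v.
Proof. by rewrite -cross_dot_alt crossC dotNl. Qed.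

End CrossTheory.

(** * Normal form of a skew derivation of the cross product *)

Section Spectral.
Variables (R : realType).

Lemma continuous_entry (T : topologicalType) m n
    (f : T -> 'M[R]_(m, n)) i j :
  continuous f -> continuous (fun x => f x i j).
Proof.
move=> fc x; apply: (@continuous_comp _ _ _ f (fun M : 'M[R]_(m, n) => M i j)).
  exact: fc.
exact: coord_continuous.
Qed.

Lemma continuous_dot n (T : topologicalType) (f g : T -> 'cV[R]_n) :
  (forall i, continuous (fun x => f x i 0)) ->
  (forall i, continuous (fun x => g x i 0)) ->
  continuous (fun x => dot (f x) (g x)).
Proof.
move=> fc gc; apply: continuous_big => [|i _].
  exact: add_continuous.
by move=> x; apply: cvgM; [exact: fc|exact: gc].
Qed.

(** At a maximum x of the quadratic form of S on the unit sphere of the subspace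
    orthogonal to s, the vector y = S x - <S x, x> x is orthogonal to x and to s;
    moving x in the direction y shows that <S x, y> = <y, y> vanishes. *)
Lemma symmetric_eigenvector n (S : 'M[R]_n) (s : seq 'cV[R]_n) :
  S^T = S -> (size s < n)%N ->
  (forall x, (forall a, a \in s -> dot a x = 0) ->
             (forall a, a \in s -> dot a (S *m x) = 0)) ->
  exists (u : 'cV[R]_n) (c : R),
    [/\ dot u u = 1, forall a, a \in s -> dot a u = 0 & S *m u = c *: u].
Proof.
move=> Ssym sn Ss.
pose perp (x : 'cV[R]_n) := forall a, a \in s -> dot a x = 0.
pose q (x : 'cV[R]_n) := dot (S *m x) x.
pose K := [set r : 'rV[R]_n | dot r^T r^T = 1 /\ perp r^T].
have coordT i : continuous (fun r : 'rV[R]_n => r^T i 0).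
  under [X in continuous X]eq_fun do rewrite mxE.
  exact: coord_continuous.
have K0 : K !=set0.
  have [x x0 sx] := exists_orthogonal sn.
  have [c cx] := exists_unit_multiple x0.
  exists ((c *: x)^T); split; rewrite trmxK//.
  by move=> a /sx ax; rewrite dotZr ax mulr0.
have Kclosed : closed K.
  rewrite (_ : K = (fun r : 'rV[R]_n => dot r^T r^T) @^-1` [set 1] `&`
      \bigcap_(a in [set a | a \in s]) (fun r : 'rV[R]_n => dot a r^T) @^-1` [set 0]).
    apply: closedI.
      apply: preimage_closed => [r _|]; last exact: closed_eq.
      exact: (continuous_dot coordT coordT).
    apply: closed_bigI => a _.
    apply: preimage_closed => [r _|]; last exact: closed_eq.
    by apply: continuous_dot => // i; exact: cst_continuous.
  by apply/seteqP; split => r [r1 r2].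
have Kbounded : bounded_set K.
  exists 1; split; first exact: num_real.
  move=> M M1 r [r1 _] /=; apply: le_trans (ltW M1).
  rewrite [leLHS]/Num.Def.normr/= mx_normrE bigmax_le// => -[i j] _ /=.
  rewrite ord1 -(@expr_le1 _ 2)// real_normK ?num_real// -[leRHS]r1 /dot (bigD1 j)//= !mxE expr2 lerDl.
  by apply: sumr_ge0 => k _; rewrite -expr2 sqr_ge0.
have qcont : continuous (fun r : 'rV[R]_n => q r^T).
  apply: continuous_dot => // i.
  under [X in continuous X]eq_fun do rewrite mxE.
  apply: continuous_big => [|j _]; first exact: add_continuous.
  move=> r; apply: continuousM; first exact: cst_continuous.
  exact: coordT.
have [r rK rmax] := compact_EVT_max K0 (bounded_closed_compact Kbounded Kclosed)
  (continuous_subspaceT qcont).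
move: rK; rewrite inE; set u := r^T => -[uu us].
exists u, (q u); split => //.
have qmax x : perp x -> q x <= q u * dot x x.
  move=> xs; have [->|x0] := eqVneq x 0; first by rewrite /q !dot0r mulr0.
  have [c cx] := exists_unit_multiple x0.
  have cc : c ^+ 2 * dot x x = 1 by rewrite -cx dotZl dotZr mulrA.
  have -> : q x = q (c *: x) * dot x x.
    by rewrite /q -scalemxAr dotZl dotZr mulrA -expr2 mulrAC cc mul1r.
  rewrite ler_wpM2r ?dot_ge0//; have := rmax (c *: x)^T; rewrite inE trmxK; apply.
  by split; rewrite trmxK// => a /xs ax; rewrite dotZr ax mulr0.
have [y yE] : exists y, y = S *m u - q u *: u by eexists.
have uy : dot u y = 0 by rewrite yE !dot_lin uu mulr1 dotC subrr.
have ys : perp y.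
  by move=> a sa; rewrite yE !dot_lin us// (Ss u us a sa) mulr0 oppr0 addr0.
have Sy : dot (S *m u) y = dot y y.
  by rewrite {2}yE !dot_lin uy mulr0 oppr0 addr0.
apply/eqP; rewrite -subr_eq0; apply/eqP; apply: dot_eq0; rewrite -yE.
(* [qmax] at u + t y reads 2 t <y, y> <= t^2 C; the choice t = <y, y> / (C + 1)
   then forces <y, y> = 0. *)
set C := q u * dot y y - q y.
have H t : 2 * t * dot y y <= t ^+ 2 * C.
  have /qmax : perp (u + t *: y).
    by move=> a sa; rewrite !dot_lin us// ys// mulr0 addr0.
  rewrite /q mulmxDr -scalemxAr !dot_lin -/(q u) -/(q y) Sy (dotC y u) uy uu.
  rewrite [dot (S *m y) u]dot_trmx Ssym (dotC y) Sy /C; lra.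
have C0 : 0 <= C by have := H 1; have := H (-1); lra.
have C1 : 0 < C + 1 by lra.
have := H (dot y y / (C + 1)); have := dot_ge0 y.
move: (dot y y) => d d0; rewrite -subr_ge0.
rewrite (_ : _ - _ = - (d / (C + 1)) ^+ 2 * (C + 2)); last first.
  by field; rewrite gt_eqF.
rewrite mulNr oppr_ge0 pmulr_lle0; last lra.
move=> d2; have : (d / (C + 1)) ^+ 2 == 0 by rewrite eq_le d2 sqr_ge0.
by rewrite sqrf_eq0 mulf_eq0 invr_eq0 (gt_eqF C1) orbF => /eqP.
Qed.

End Spectral.

Section Frame.
Variables (R : realType) (xi : 'M[R]_7).
Hypothesis skew : xi^T = - xi.
Hypothesis derivation : forall u v : 'cV[R]_7,
  xi *m cross u v = cross (xi *m u) v + cross u (xi *m v).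
Implicit Types e p u v w : 'cV[R]_7.

Lemma dot_skew u v : dot (xi *m u) v = - dot u (xi *m v).
Proof. by rewrite dot_trmx skew mulNmx dotNr. Qed.

(** A skew matrix of odd size is singular. *)
Lemma skew_kernel : exists e, dot e e = 1 /\ xi *m e = 0.
Proof.
have detxi : \det xi = 0.
  have := det_tr xi; rewrite skew -scaleN1r detZ -signr_odd /= expr1 mulN1r; lra.
have k0 : kermx xi != 0.
  by rewrite kermx_eq0 row_free_unit unitmxE unitfE detxi eqxx.
pose x := (nz_row (kermx xi))^T.
have x0 : x != 0 by rewrite -trmx0 (inj_eq trmx_inj) nz_row_eq0.
have xx0 : xi *m x = 0.
  have /sub_kermxP H := nz_row_sub (kermx xi).
  have := congr1 trmx H; rewrite trmx_mul skew trmx0 mulNmx => /eqP.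
  by rewrite oppr_eq0 => /eqP.
have [c cx] := exists_unit_multiple x0; exists (c *: x); split=> //.
by rewrite -scalemxAr xx0 scaler0.
Qed.

Section UnitKernel.
Variable e : 'cV[R]_7.
Hypotheses (e1 : dot e e = 1) (xie : xi *m e = 0).

Lemma xi_crosse u : xi *m cross e u = cross e (xi *m u).
Proof.
by rewrite derivation xie -[X in cross X u](scale0r e) crossZl scale0r add0r.
Qed.

Lemma xi_orth u : dot e (xi *m u) = 0.
Proof. by apply/eqP; rewrite -oppr_eq0 -dot_skew xie dot0l. Qed.

Lemma crosse_crosse u : dot e u = 0 -> cross e (cross e u) = - u.
Proof. by move=> eu; rewrite cross_cross_same eu e1 scale0r scale1r sub0r. Qed.

(** The operator e x xi is symmetric, as a product of two commuting skew
    operators; on the orthogonal of e, its eigenvectors for - c are the solutions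
    of xi u = c (e x u), since e x squares to -1. *)
Lemma rotated_line (s : seq 'cV[R]_7) : (size s < 7)%N -> e \in s ->
  (forall a, a \in s -> exists c, cross e (xi *m a) = c *: a) ->
  exists u c, [/\ dot u u = 1, forall a, a \in s -> dot a u = 0 &
                  xi *m u = c *: cross e u].
Proof.
move=> s7 es sE; have [M ME] := cross_mulmx e.
have MT : M^T = - M.
  apply/matrixP => i j; rewrite !mxE !entry_dot -!ME.
  by rewrite dotC dot_cross_swap dotC.
have SM : (M *m xi)^T = M *m xi.
  rewrite trmx_mul MT skew mulmxN mulNmx opprK.
  apply/matrixP => i j; have := xi_crosse (delta_mx j 0).
  rewrite !ME !mulmxA -!colE => /colP/(_ i).
  by rewrite [LHS]mxE [RHS]mxE.
have [|u [c [uu us uE]]] := symmetric_eigenvector SM s7.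
  move=> x xs a sa; rewrite dotC dot_trmx SM -mulmxA -ME dotC.
  by have [d ->] := sE a sa; rewrite dotZl xs ?mulr0.
exists u, (- c); split => //.
have := congr1 (cross e) uE.
rewrite -mulmxA -ME (crosse_crosse (xi_orth u)) crossZr => H.
by rewrite scaleNr -H opprK.
Qed.

(** The component of the cross product orthogonal to e is antilinear for the
    complex structure e x. This is why the rate of u x v is the opposite of the
    sum of the rates of u and v. *)
Lemma antilinear u v : dot e u = 0 -> dot e v = 0 -> dot u v = 0 ->
  cross u (cross e v) = - cross e (cross u v).
Proof.
move=> eu ev uv; apply/eqP; rewrite -addr_eq0; apply/eqP.
by rewrite cross_cross uv ev (dotC u e) eu mulr0 !scale0r subr0 addr0.
Qed.

End UnitKernel.

Definition of_three (T : Type) (x y z : T) (i : 'I_3) : T := nth x [:: x; y; z] i.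

(** The restriction of xi to the orthogonal of e, seen as C^3, belongs to su(3):
    a unitary basis in which it is diagonal is u, v, u x v for two eigenvectors
    u and v, and the trace vanishes by [antilinear]. *)
Lemma unitary_frame : exists (e : 'cV[R]_7) (U : 'I_3 -> 'cV[R]_7) (a : 'I_3 -> R),
  [/\ dot e e = 1 /\ xi *m e = 0,
      \sum_i a i = 0,
      forall i, dot e (U i) = 0 /\ xi *m U i = a i *: cross e (U i),
      forall i j, dot (U i) (U j) = (i == j)%:R &
      forall i j, dot (cross e (U i)) (U j) = 0].
Proof.
have [e [e1 xie]] := skew_kernel.
have [|u [a [uu us uE]]] := rotated_line e1 xie (s := [:: e]) isT (mem_head _ _).
  by move=> x; rewrite inE => /eqP ->; exists 0; rewrite xie -(scale0r e) crossZr !scale0r.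
have eu : dot e u = 0 by apply: us; rewrite mem_head.
have u'E : cross e (xi *m u) = (- a) *: u.
  by rewrite uE crossZr crosse_crosse// scalerN scaleNr.
have [|v [b [vv vs vE]]] :=
    rotated_line e1 xie (s := [:: e; u; cross e u]) isT (mem_head _ _).
  move=> x; rewrite !inE => /or3P[] /eqP ->.
  - by exists 0; rewrite xie -(scale0r e) crossZr !scale0r.
  - by exists (- a).
  - by exists (- a); rewrite xi_crosse// u'E crossZr.
have ev : dot e v = 0 by apply: vs; rewrite !inE eqxx.
have uv : dot u v = 0 by apply: vs; rewrite !inE eqxx ?orbT.
have u'v : dot (cross e u) v = 0 by apply: vs; rewrite !inE eqxx ?orbT.
pose w := cross u v.
have ew : dot e w = 0 by rewrite /w -cross_dot_alt.
have uw : dot u w = 0 by rewrite dot_crossl.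
have vw : dot v w = 0 by rewrite dot_crossr.
have ww : dot w w = 1 by rewrite cross_norm uu vv uv expr0n subr0 mulr1.
have u'w : dot (cross e u) w = 0.
  by rewrite cross_dot_alt cross_cross_same uv uu scale0r scale1r sub0r dotNr ev oppr0.
have v'w : dot (cross e v) w = 0.
  rewrite cross_dot_alt /w (crossC v u) crossNr cross_cross_same.
  by rewrite (dotC v u) uv vv scale0r scale1r sub0r opprK.
have wE : xi *m w = (- (a + b)) *: cross e w.
  have vu : dot v u = 0 by rewrite dotC.
  rewrite derivation uE vE crossZl crossZr (antilinear eu ev uv).
  rewrite (crossC v) (antilinear ev eu vu) (crossC u v) crossNr opprK.
  by rewrite -/w !scalerN -opprD -scalerDl scaleNr.
exists e, (of_three u v w), (of_three a b (- (a + b))); split => //.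
- by rewrite !big_ord_recl big_ord0 /= /of_three /= addr0; lra.
- by case=> -[|[|[|//]]] ?.
- case=> -[|[|[|//]]] ?; case=> -[|[|[|//]]] ?; rewrite /of_three //=;
  by rewrite dotC.
- have sw x y : dot (cross e x) y = - dot (cross e y) x.
    by rewrite -dot_cross_swap dotC.
  have ss x : dot (cross e x) x = 0 by have := sw x x; lra.
  case=> -[|[|[|//]]] ?; case=> -[|[|[|//]]] ?; rewrite /of_three //=;
  by rewrite sw ?u'v ?u'w ?v'w oppr0.
Qed.

Lemma orbit_decomposition p : exists (e : 'cV[R]_7) (A : 'I_3 -> 'cV[R]_7)
    (a : 'I_3 -> R) (c : R),
  [/\ dot e e = 1 /\ xi *m e = 0,
      \sum_i a i = 0,
      forall i, dot e (A i) = 0 /\ xi *m A i = a i *: cross e (A i),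
      forall i j, i != j -> dot (A i) (A j) = 0 /\ dot (cross e (A i)) (A j) = 0 &
      p = c *: e + \sum_i A i].
Proof.
have [e [U [a [[e1 xie] a0 UE UU U'U]]]] := unitary_frame.
pose A i := dot (U i) p *: U i + dot (cross e (U i)) p *: cross e (U i).
pose f (k : 'I_7) := nth e [:: e; U 0; U 1; U 2%:R; cross e (U 0); cross e (U 1);
                      cross e (U 2%:R)] k.
have eU i : dot e (U i) = 0 by have [] := UE i.
have eU' i : dot e (cross e (U i)) = 0 by rewrite dot_crossl.
have U'U' i j : dot (cross e (U i)) (cross e (U j)) = (i == j)%:R.
  by rewrite dot_cross_cross.
have UU' i j : dot (U i) (cross e (U j)) = 0 by rewrite dotC.
have fo i j : dot (f i) (f j) = (i == j)%:R.
  wlog ij : i j / (i <= j)%N.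
    by move=> H; case/orP: (leq_total i j) => /H//; rewrite dotC eq_sym.
  case: i j ij => -[|[|[|[|[|[|[|//]]]]]]] ? [] [|[|[|[|[|[|[|//]]]]]]] ? //= _;
  by rewrite /f /= ?(e1, eU, eU', UU, UU', U'U, U'U').
exists e, A, a, (dot e p); split => //.
- move=> i; split; first by rewrite /A !dot_lin eU eU' !mulr0 addr0.
  have [_ UiE] := UE i.
  rewrite /A mulmxDr -!scalemxAr xi_crosse// UiE crossDr !crossZr scalerDr.
  by rewrite !scalerA ![a i * _]mulrC.
- move=> i j ij.
  rewrite /A !crossDr !crossZr crosse_crosse// !dot_lin.
  by rewrite !(UU, U'U, UU', U'U') (negPf ij) !(mulr0, addr0, oppr0).
- rewrite {1}(orthonormal_expansion p fo) !big_ord_recr !big_ord0 /= !add0r /f /=.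
  rewrite /A.
  have -> : widen_ord (leqnSn 2) (widen_ord (leqnSn 1) ord_max) = 0 :> 'I_3.
    exact/val_inj.
  have -> : widen_ord (leqnSn 2) ord_max = 1 :> 'I_3 by exact/val_inj.
  have -> : ord_max = 2%:R :> 'I_3 by exact/val_inj.
  by apply/colP => k; rewrite !mxE; ring.
Qed.

End Frame.

(** * Linear differential equations, the exponential and the Lie algebra of G_2 *)

Section Curves.
Variables (R : realType).

Lemma cvg_mx (T : Type) (F : set_system T) (FF : Filter F) m n
    (f : T -> 'M[R]_(m, n)) (l : 'M[R]_(m, n)) :
  (forall i j, f x i j @[x --> F] --> l i j) -> f @ F --> l.
Proof.
move=> fl; apply/cvgrPdist_le => /= e e0; near=> x.
rewrite /Num.Def.normr/= mx_normrE (bigmax_le _ (ltW e0))//= => i _.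
rewrite !mxE/=; move: i; near: x; apply: filter_forall => /= i.
exact: ((cvgrPdist_le _ _).1 (fl i.1 i.2)).
Unshelve. all: by end_near. Qed.

Lemma is_derive_colP (V : normedModType R) n (f : V -> 'cV[R]_n) x v l :
  is_derive x v f l <-> forall i, is_derive x v (fun y => f y i 0) (l i 0).
Proof.
split=> [[df fl] i|H].
  have /derivable_mxP/(_ i 0) dfi := df.
  by split=> //; rewrite -fl derive_mx// mxE.
have df : derivable f x v.
  by apply/derivable_mxP => i j; rewrite ord1; case: (H i).
split=> //; rewrite derive_mx//; apply/colP => i.
by rewrite mxE; case: (H i).
Qed.

Lemma is_derive_bigsum (V : normedModType R) n (h : 'I_n -> V -> R)
    (x v : V) (dh : 'I_n -> R) :
  (forall i, is_derive x v (h i) (dh i)) ->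
  is_derive x v (fun y => \sum_i h i y) (\sum_i dh i).
Proof.
move=> H; have -> : (fun y => \sum_i h i y) = \sum_i h i.
  by apply/funext => y; rewrite fct_sumE.
exact: is_derive_sum.
Qed.

Lemma is_derive_dot n (V : normedModType R) (f g : V -> 'cV[R]_n) (x v : V) df dg :
  is_derive x v f df -> is_derive x v g dg ->
  is_derive x v (fun y => dot (f y) (g y)) (dot df (g x) + dot (f x) dg).
Proof.
move=> /is_derive_colP Hf /is_derive_colP Hg.
rewrite /dot -big_split /=; apply: is_derive_bigsum => i.
rewrite addrC [df i 0 * _]mulrC.
exact: (is_deriveM (Hf i) (Hg i)).
Qed.

Lemma is_derive_mulmx m n (M : 'M[R]_(m, n)) (V : normedModType R)
    (f : V -> 'cV[R]_n) (x v : V) df :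
  is_derive x v f df -> is_derive x v (fun y => M *m f y) (M *m df).
Proof.
move=> /is_derive_colP Hf; apply/is_derive_colP => i.
under eq_fun do rewrite mxE.
rewrite mxE; apply: is_derive_bigsum.
Qed.

Lemma is_derive_unique (V W : normedModType R) (f : V -> W) x v l l' :
  is_derive x v f l -> is_derive x v f l' -> l = l'.
Proof. by move=> [_ <-] [_ <-]. Qed.

Lemma is_derive_cross (f g : R -> 'cV[R]_7) (t : R) df dg :
  is_derive t (1 : R) f df -> is_derive t (1 : R) g dg ->
  is_derive t (1 : R) (fun s => cross (f s) (g s)) (cross df (g t) + cross (f t) dg).
Proof.
move=> Hf Hg; apply/is_derive_colP => k.
have [M ME] := cross_mulmx (delta_mx k 0 : 'cV[R]_7).
have crossk (u v : 'cV[R]_7) : cross u v k 0 = dot u ((- M) *m v).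
  by rewrite -dot_delta cross_dot_alt crossC ME mulNmx.
rewrite [X in is_derive _ _ _ X]mxE; under eq_fun do rewrite crossk.
by rewrite !crossk; apply: is_derive_dot => //; exact: is_derive_mulmx.
Qed.

End Curves.

Section LinearODE.
Variables (R : realType) (n : nat) (A : 'M[R]_n).

Definition solves (f : R -> 'cV[R]_n) := forall t : R, is_derive t (1 : R) f (A *m f t).

Lemma solves_mulmx M f : M *m A = A *m M -> solves f -> solves (fun t => M *m f t).
Proof.
by move=> MA fA t; rewrite mulmxA -MA -mulmxA; apply: is_derive_mulmx; exact: fA.
Qed.

Hypothesis skew : A^T = - A.

Lemma skew_dot_const f g : solves f -> solves g ->
  forall s t, dot (f s) (g s) = dot (f t) (g t).
Proof.
move=> fA gA s t; apply: (is_derive_0_is_cst (f := fun s => dot (f s) (g s))) => r.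
have := is_derive_dot (fA r) (gA r).
by rewrite dot_trmx skew mulNmx dotNr addNr.
Qed.

(** The difference of two solutions is a solution, and its norm is constant. *)
Lemma skew_solves_unique f g : solves f -> solves g -> f 0 = g 0 -> f = g.
Proof.
move=> fA gA fg0; apply/funext => t; apply/eqP; rewrite -subr_eq0; apply/eqP.
have hA : solves (fun t => f t - g t).
  by move=> s; rewrite mulmxBr; apply: is_deriveB; [exact: fA|exact: gA].
by apply: dot_eq0; rewrite (skew_dot_const hA hA t 0) fg0 subrr dot0l.
Qed.

End LinearODE.

Section Exponential.
Variables (R : realType) (xi : 'M[R]_7).

(** Coefficients of the power series, in t, of an entry of A exp (t xi). The factor
    A makes the family stable under differentiation, which multiplies A by xi. *)
Definition expcoef (A : 'M[R]_7) i j (k : nat) : R :=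
  (k`!%:R)^-1 * (A * xi ^+ k) i j.

Lemma pseries_diffs_expcoef A i j :
  pseries_diffs (expcoef A i j) = expcoef (A * xi) i j.
Proof.
apply/funext => k; rewrite /pseries_diffs /expcoef factS natrM invfM exprS.
by rewrite -!mulrA mulVKf ?pnatr_eq0.
Qed.

Lemma entry_powers_le : exists M : R, 0 <= M /\
  forall (A : 'M[R]_7), exists2 B, 0 <= B & forall k i j, `|(A * xi ^+ k) i j| <= B * M ^+ k.
Proof.
exists (\sum_i \sum_j `|xi i j|); split.
  by do 2 (apply: sumr_ge0 => ? _).
set M := \sum_i \sum_j `|xi i j|.
move=> A; exists (\sum_i \sum_j `|A i j|); first by do 2 (apply: sumr_ge0 => ? _).
elim=> [|k IH] i j.
  rewrite expr0 !mulr1 (bigD1 i)//= (bigD1 j)//= -addrA lerDl addr_ge0//.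
    by apply: sumr_ge0.
  by do 2 (apply: sumr_ge0 => ? _).
rewrite exprSr mulrA -mulmxE mxE exprSr mulrA.
apply: le_trans (ler_norm_sum _ _ _) _.
rewrite [leRHS]mulr_sumr; apply: ler_sum => l _; rewrite normrM.
rewrite mulmxE; apply: ler_pM => //.
by rewrite (bigD1 j)//= lerDl; apply: sumr_ge0.
Qed.

Lemma is_cvg_expcoef A i j t : cvgn (pseries (expcoef A i j) t).
Proof.
have [M [M0 /(_ A)[B B0 H]]] := entry_powers_le.
apply: normed_cvg.
apply: (@series_le_cvg _ _ (B *: exp_coeff (M * `|t|))).
- by move=> n /=.
- by move=> n; rewrite mulr_ge0// divr_ge0// exprn_ge0// mulr_ge0.
- move=> k; rewrite /= /expcoef /exp_coeff /= !normrM normfV normr_nat normrX.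
  rewrite [leRHS](_ : _ = k`!%:R^-1 * (B * M ^+ k) * `|t| ^+ k).
    by rewrite ler_wpM2r ?exprn_ge0// ler_wpM2l// invr_ge0.
  by rewrite -[LHS]/(B * ((M * `|t|) ^+ k / k`!%:R)) exprMn; ring.
rewrite (_ : series _ = B *: series (exp_coeff (M * `|t|))); last first.
  apply/funext => n; rewrite -[RHS]/(B * series (exp_coeff (M * `|t|)) n).
  by rewrite /series /= mulr_sumr.
apply: is_cvgZr; exact: is_cvg_series_exp_coeff.
Qed.

Definition expm (A : 'M[R]_7) (t : R) i j : R := limn (pseries (expcoef A i j) t).

Lemma is_derive_expm A i j (t : R) :
  is_derive t (1 : R) (fun s => expm A s i j) (expm (A * xi) t i j).
Proof.
rewrite /expm -pseries_diffs_expcoef.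
apply: (@pseries_snd_diffs _ _ (`|t| + 1)); rewrite ?pseries_diffs_expcoef;
  try exact: is_cvg_expcoef.
by rewrite [ltRHS]ger0_norm ?addr_ge0// ltrDl.
Qed.

(** The exponential is a limit in the space of matrices, which is computed entry
    by entry. *)
Lemma mulmx_expm A (t : R) : A *m mexp (t *: xi) = \matrix_(i, j) expm A t i j.
Proof.
have cvgE B i j : pseries (expcoef B i j) t @ \oo --> expm B t i j.
  exact: is_cvg_expcoef.
have partial B n : \matrix_(i, j) pseries (expcoef B i j) t n =
    B *m series (fun k => (k`!%:R)^-1 *: (t *: xi) ^+ k) n.
  apply/matrixP => i j; rewrite mxE /pseries /series /= mulmx_sumr summxE.
  apply: eq_bigr => k _; rewrite exprZn scalerA -scalemxAr mxE /expcoef.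
  by rewrite mulmxE mulrAC.
have mexpE : mexp (t *: xi) = \matrix_(i, j) expm 1 t i j.
  apply/cvg_lim => //; apply: cvg_mx => i j; rewrite mxE.
  rewrite (_ : (fun x => _) = pseries (expcoef 1 i j) t); first exact: cvgE.
  by apply/funext => n; have /matrixP/(_ i j) := partial 1 n; rewrite mul1mx mxE => ->.
apply/matrixP => i j; rewrite [RHS]mxE; apply/esym/cvg_lim => //.
rewrite (_ : pseries _ t = fun n => \sum_k A i k * pseries (expcoef 1 k j) t n).
  rewrite mxE; apply: cvg_big => [|k _]; first exact: add_continuous.
  have H : pseries (expcoef 1 k j) t @ \oo --> mexp (t *: xi) k j.
    by rewrite mexpE mxE; exact: cvgE.
  exact: (cvgM (cvg_cst (A i k)) H).
apply/funext => n; have /matrixP/(_ i j) := partial A n; rewrite mxE => ->.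
rewrite mxE; apply: eq_bigr => k _; congr (_ * _).
by have /matrixP/(_ k j) := partial 1 n; rewrite mul1mx mxE => ->.
Qed.

Lemma mexp0 : mexp (0 *: xi) = 1%:M.
Proof.
rewrite /mexp scale0r; apply/cvg_lim => //; apply: cvg_near_cst.
exists 1%N => // -[//|n] _ /=.
rewrite /series /= big_nat_recl// big1 => [|k _].
  by rewrite expr0 fact0 invr1 scale1r addr0.
by rewrite expr0n scaler0.
Qed.

Lemma solves_flow p : solves xi (flow xi p).
Proof.
move=> t; rewrite /flow mulmxA.
have -> : xi *m mexp (t *: xi) = \matrix_(i, j) expm xi t i j by exact: mulmx_expm.
apply/is_derive_colP => i.
have flowE (s : R) : (mexp (s *: xi) *m p) i 0 = \sum_j expm 1 s i j * p j 0.
  rewrite -[mexp _]mul1mx mulmx_expm mxE.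
  by apply: eq_bigr => j _; rewrite mxE.
under eq_fun do rewrite flowE.
rewrite mxE; apply: is_derive_bigsum => j; rewrite mxE.
rewrite (_ : (fun s : R => _) = p j 0 *: (fun s => expm 1 s i j)); last first.
  by apply/funext => s; rewrite mulrC.
by rewrite mulrC -(mul1r xi); exact: (is_deriveZ (p j 0) (is_derive_expm 1 i j t)).
Qed.

Lemma flow0 p : flow xi p 0 = p.
Proof. by rewrite /flow mexp0 mul1mx. Qed.

Lemma flow_derivative p (t : R) : 'D_1 (flow xi p) t = xi *m flow xi p t.
Proof. by have [_ ->] := solves_flow p t. Qed.

Lemma fundvfE p : fundvf xi p = xi *m p.
Proof. by rewrite /fundvf flow_derivative flow0. Qed.

End Exponential.

Section LieAlgebra.
Variable R : realType.

(** The square of an imaginary octonion x is - <x, x>, so that an automorphism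
    preserves the norm, and the scalar product by polarization. *)
Lemma G2_dot (g : 'M[R]_7) u v : G2 R g -> dot (g *m u) (g *m v) = dot u v.
Proof.
move=> [phi [[_ phi1 phiM] phig]].
have norm x : dot (g *m x) (g *m x) = dot x x.
  have sq (y : 'cV[R]_7) : omul (oimag y) (oimag y) = - dot y y *: oone R.
    apply/colP => k; rewrite [RHS]mxE; case: (unliftP 0 k) => [j|] ->.
      have := cross_sum y y j; rewrite crossvv mxE omul_imagS => <-.
      by rewrite mxE mulr0.
    by rewrite omul_imag0 mxE !eqxx mulr1.
  have := phiM (oimag x) (oimag x); rewrite phig !sq linearZ phi1 => /colP/(_ 0).
  rewrite !mxE !eqxx !mulr1 => /eqP; rewrite eqr_opp => /eqP -> //.
have := norm (u + v); rewrite mulmxDr !dot_lin !norm.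
rewrite (dotC (g *m v)) (dotC v); lra.
Qed.

Lemma G2_cross (g : 'M[R]_7) u v : G2 R g ->
  cross (g *m u) (g *m v) = g *m cross u v.
Proof.
move=> gG; case: (gG) => phi [[_ phi1 phiM] phig].
have crossE x y : oimag (cross x y) =
    2^-1 *: (omul (oimag x) (oimag y) - omul (oimag y) (oimag x)).
  apply/colP => k; case: (unliftP 0 k) => [j|] ->.
    rewrite oimagS /cross /ovec mxE; congr (fun_of_matrix _ _ _); exact/val_inj.
  rewrite oimag0 mxE [X in _ * X]mxE [X in _ + X]mxE !omul_imag0.
  by rewrite (dotC y) subrr mulr0.
have inj x y : oimag x = oimag y :> octonion R -> x = y.
  by move=> xy; apply/colP => k; rewrite -!oimagS xy.
by apply: inj; rewrite crossE -!phig -!phiM -linearB -linearZ -crossE.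
Qed.

Variables (xi : 'M[R]_7) (xi_g2 : g2 R xi).

(** Derivative at t = 0 of <exp (t xi) u, exp (t xi) v> = <u, v>. *)
Lemma g2_skew : xi^T = - xi.
Proof.
have H u v : dot (xi *m u) v + dot u (xi *m v) = 0.
  have := is_derive_dot (solves_flow xi u 0) (solves_flow xi v 0).
  rewrite !flow0; under eq_fun do rewrite (G2_dot _ _ (xi_g2 _)).
  by move=> H; apply: is_derive_unique H _; exact: is_derive_cst.
apply/matrixP => i j; rewrite !mxE !entry_dot.
have := H (delta_mx j 0) (delta_mx i 0); rewrite [X in _ + X]dotC; lra.
Qed.

(** Derivative at t = 0 of exp (t xi) u x exp (t xi) v = exp (t xi) (u x v). *)
Lemma g2_derivation u v :
  xi *m cross u v = cross (xi *m u) v + cross u (xi *m v).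
Proof.
have := is_derive_cross (solves_flow xi u 0) (solves_flow xi v 0).
rewrite !flow0; under eq_fun do rewrite (G2_cross _ _ (xi_g2 _)).
move=> H; apply: is_derive_unique _ H.
by have := solves_flow xi (cross u v) 0; rewrite flow0.
Qed.

End LieAlgebra.

(** * Calculus of smooth maps *)

Section SmoothCalculus.
Variables (R : realType).

Section Generic.
Variables (V W : normedModType R) (U : set V).
Implicit Types f g : V -> W.

Lemma Ck_continuous k f : Ck k U f -> forall x, U x -> {for x, continuous f}.
Proof. by case: k => [//|k] []. Qed.

Lemma Ck_pred k f : Ck k.+1 U f -> Ck k U f.
Proof.
elim: k f => [|k IH] f; first by case.
move=> [fc fd]; split=> // v; have [dfv Df] := fd v.
by split=> //; exact: IH.
Qed.

Hypothesis Uopen : open U.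

Lemma near_open (P : V -> Prop) x : U x -> (forall y, U y -> P y) -> \forall y \near x, P y.
Proof. by move=> Ux UP; apply: filterS UP _; apply: open_nbhs_nbhs. Qed.

Lemma Ck_eq k f g : (forall x, U x -> f x = g x) -> Ck k U f -> Ck k U g.
Proof.
have cont_eq f1 f2 : (forall x, U x -> f1 x = f2 x) ->
    (forall x, U x -> {for x, continuous f1}) ->
    forall x, U x -> {for x, continuous f2}.
  move=> f12 f1c x Ux; suff : f2 @ x --> f1 x by rewrite f12.
  apply: cvg_trans (f1c _ Ux); apply: near_eq_cvg.
  by apply: near_open Ux _ => y Uy; rewrite f12.
elim: k f g => [|k IH] f g fg /=; first exact: cont_eq.
move=> [fc fd]; split; first exact: cont_eq fc.
move=> v; have [dfv Df] := fd v.
have near x : U x -> \forall y \near x, f y = g y.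
  by move=> Ux; apply: near_open Ux _.
split=> [x Ux|]; first exact: near_eq_derivable (near x Ux) (dfv x Ux).
by apply: IH Df => x Ux; exact: near_eq_derive (near x Ux).
Qed.

(** The form in which [Ck] is established by induction: directional derivatives
    need a formula on the open set U only. *)
Lemma Ck_of_is_derive k f (df : V -> V -> W) :
  (forall x, U x -> {for x, continuous f}) ->
  (forall v x, U x -> is_derive x v f (df v x)) ->
  (forall v, Ck k U (df v)) -> Ck k.+1 U f.
Proof.
move=> fc fd Df; split=> // v; split=> [x Ux|]; first by case: (fd v x Ux).
by apply: Ck_eq (Df v) => x Ux; case: (fd v x Ux) => _ ->.
Qed.

Lemma Ck_cst k (c : W) : Ck k U (fun=> c).
Proof.
elim: k c => [|k IH] c; first by move=> x _; exact: cvg_cst.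
apply: (@Ck_of_is_derive _ _ (fun _ _ => 0)) => //.
by move=> x _; exact: cvg_cst.
Qed.

Lemma Ck_is_derive k f v x : Ck k.+1 U f -> U x -> is_derive x v f ('D_v f x).
Proof. by move=> [_ /(_ v)[H _]] /H. Qed.

Lemma Ck_derive k f v : Ck k.+1 U f -> Ck k U ('D_v f).
Proof. by move=> [_ /(_ v)[]]. Qed.

Lemma CkD k f g : Ck k U f -> Ck k U g -> Ck k U (fun x => f x + g x).
Proof.
elim: k f g => [|k IH] f g Hf Hg.
  by move=> x Ux; apply: cvgD; [exact: Hf|exact: Hg].
apply: (@Ck_of_is_derive _ _ (fun v x => 'D_v f x + 'D_v g x)).
- by move=> x Ux; apply: cvgD; [exact: (Ck_continuous Hf)|exact: (Ck_continuous Hg)].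
- move=> v x Ux.
  exact: (is_deriveD (Ck_is_derive v Hf Ux) (Ck_is_derive v Hg Ux)).
- by move=> v; apply: IH; exact: Ck_derive.
Qed.

End Generic.

Section Scalar.
Variables (V : normedModType R) (U : set V).
Hypothesis Uopen : open U.
Implicit Types f g : V -> R.

Lemma CkM k f g : Ck k U f -> Ck k U g -> Ck k U (fun x => f x * g x).
Proof.
elim: k f g => [|k IH] f g Hf Hg.
  by move=> x Ux; apply: cvgM; [exact: Hf|exact: Hg].
apply: (@Ck_of_is_derive _ _ _ Uopen _ _ (fun v x => f x * 'D_v g x + g x * 'D_v f x)).
- by move=> x Ux; apply: cvgM; [exact: (Ck_continuous Hf)|exact: (Ck_continuous Hg)].
- move=> v x Ux.
  exact: (is_deriveM (Ck_is_derive v Hf Ux) (Ck_is_derive v Hg Ux)).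
- by move=> v; apply: CkD => //; apply: IH; by [exact: Ck_derive|exact: Ck_pred].
Qed.

Lemma CkN k f : Ck k U f -> Ck k U (fun x => - f x).
Proof.
move=> Hf; apply: (Ck_eq Uopen (f := fun x => (-1) * f x)).
  by move=> x _; rewrite mulN1r.
by apply: CkM => //; exact: Ck_cst.
Qed.

(** A directional derivative is a derivative along a line, so that the chain rule
    of one real variable suffices. *)
Lemma is_derive_outer f (g : R -> R) (x v : V) df dg :
  is_derive x v f df -> is_derive (f x) (1 : R) g dg ->
  is_derive x v (fun y => g (f y)) (dg * df).
Proof.
have line (h : V -> R) dh : is_derive x v h dh <->
    is_derive (0 : R) (1 : R) (fun t : R => h (t *: v + x)) dh.
  have E : 'D_1 (fun t : R => h (t *: v + x)) (0 : R) = 'D_v h x.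
    rewrite /derive; set g1 := fun t => t^-1 *: _; set g2 := fun t => t^-1 *: _.
    suff -> : g1 = g2 by []; apply/funext => t; rewrite /g1 /g2 /=.
    by rewrite addr0 scale0r add0r [t *: 1]mulr1.
  split=> [[hd hE]|[hd hE]].
    by split; [exact: ((derivable1P _ _ _).1 hd)|rewrite E].
  by split; [exact: ((derivable1P _ _ _).2 hd)|rewrite -E].
move=> /line Hf Hg; apply/line.
apply: (@is_derive1_comp _ g (fun t : R => f (t *: v + x))) => //.
by rewrite scale0r add0r.
Qed.

(** Here [h] is a family of functions whose derivatives are expressed
    through the family itself, such as cos and sin, or t^-1 alone. *)
Lemma Ck_outer (I : Type) (h dh : I -> R -> R) (P : set R) f :
  (forall i t, P t -> is_derive t (1 : R) (h i) (dh i t)) ->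
  (forall x, U x -> P (f x)) ->
  (forall k, Ck k U f -> (forall i, Ck k U (fun x => h i (f x))) ->
    forall i, Ck k U (fun x => dh i (f x))) ->
  forall k, Ck k U f -> forall i, Ck k U (fun x => h i (f x)).
Proof.
move=> hd UP system.
have cont i x : U x -> {for x, continuous f} -> {for x, continuous (fun x => h i (f x))}.
  move=> Ux fx; apply: (@continuous_comp _ _ _ f (h i)) => //.
  have [hid _] := hd i _ (UP x Ux).
  exact/differentiable_continuous/derivable1_diffP.
elim=> [|k IH] Hf i; first by move=> x Ux; apply: cont => //; exact: Hf.
apply: (@Ck_of_is_derive _ _ _ Uopen _ _ (fun v x => dh i (f x) * 'D_v f x)).
- by move=> x Ux; apply: cont => //; exact: (Ck_continuous Hf).
- move=> v x Ux; apply: is_derive_outer; first exact: (Ck_is_derive v Hf Ux).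
  exact: hd (UP x Ux).
- move=> v; apply: CkM; last exact: Ck_derive.
  by apply: system; [|apply: IH]; exact: Ck_pred.
Qed.

Lemma Ck_cos_sin k f : Ck k U f ->
  Ck k U (fun x => cos (f x)) /\ Ck k U (fun x => sin (f x)).
Proof.
pose h (b : bool) : R -> R := if b then cos else sin.
pose dh (b : bool) : R -> R := if b then (fun t => - sin t) else cos.
move=> Hf; suff H b : Ck k U (fun x => h b (f x)) by split; [exact: (H true)|exact: (H false)].
apply: (@Ck_outer _ h dh setT) => //.
- by move=> [] t _; [exact: is_derive_cos|exact: is_derive_sin].
- move=> m Hfm Hh [] /=; last exact: (Hh true).
  by apply: CkN; exact: (Hh false).
Qed.

Lemma Ck_inv k f : (forall x, U x -> f x != 0) -> Ck k U f ->
  Ck k U (fun x => (f x)^-1).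
Proof.
move=> f0 Hf.
apply: (@Ck_outer unit (fun _ t => t^-1) (fun _ t => - (t^-1 * t^-1)) [set t | t != 0]) => //.
- move=> _ t t0; have := is_deriveV t0 (is_derive_id t (1 : R)).
  by rewrite /GRing.scale /= mulr1 expr2 invfM.
- by move=> m Hfm Hh _; apply: CkN; apply: CkM; exact: (Hh tt).
Qed.

Lemma Ck_atan k f : Ck k U f -> Ck k U (fun x => atan (f x)).
Proof.
move=> Hf.
apply: (@Ck_outer unit (fun _ => atan) (fun _ t => (1 + t ^+ 2)^-1) setT) => //.
move=> m Hfm _ _; apply: Ck_inv.
  by move=> x _; rewrite gt_eqF// ltr_wpDr// sqr_ge0.
by apply: CkD; [|exact: Ck_cst|exact: (CkM Hfm Hfm)].
Qed.

Lemma Ck_linear k f : continuous f ->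
  (forall h v x, f (h *: v + x) = h * f v + f x) -> Ck k U f.
Proof.
move=> fc flin; case: k => [|k]; first by move=> x _; exact: fc.
apply: (@Ck_of_is_derive _ _ _ Uopen _ _ (fun v _ => f v)).
- by move=> x _; exact: fc.
- move=> v x _; have cvgq : h^-1 *: (f (h *: v + x) - f x) @[h --> (0 : R)^'] --> f v.
    apply: cvg_near_cst; near=> h.
    rewrite flin addrK [_ *: _]mulrA mulVf ?mul1r//.
    by near: h; exact: nbhs_dnbhs_neq.
  by split; [apply/cvg_ex; exists (f v)|exact/cvg_lim].
- by move=> v; exact: Ck_cst.
Unshelve. all: by end_near. Qed.

Lemma Ck_col k n (f : V -> 'cV[R]_n) :
  (forall i, Ck k U (fun x => f x i 0)) -> Ck k U f.
Proof.
have cont (g : V -> 'cV[R]_n) x : (forall i, {for x, continuous (fun x => g x i 0)}) ->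
    {for x, continuous g}.
  by move=> H; apply: cvg_mx => i j; rewrite ord1; exact: H.
elim: k f => [|k IH] f Hf; first by move=> x Ux; apply: cont => i; exact: Hf.
apply: (@Ck_of_is_derive _ _ _ Uopen _ _
  (fun v x => \col_i 'D_v (fun y => f y i 0) x)).
- by move=> x Ux; apply: cont => i; exact: (Ck_continuous (Hf i)).
- move=> v x Ux; apply/is_derive_colP => i; rewrite mxE.
  exact: Ck_is_derive (Hf i) Ux.
- move=> v; apply: IH => i; under eq_fun do rewrite mxE.
  exact: Ck_derive (Hf i).
Qed.

Lemma Ck_bigsum k n (f : 'I_n -> V -> R) :
  (forall i, Ck k U (f i)) -> Ck k U (fun x => \sum_i f i x).
Proof.
elim: n f => [|n IH] f Hf.
  by under eq_fun do rewrite big_ord0; exact: Ck_cst.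
by under eq_fun do rewrite big_ord_recl; apply: CkD => //; exact: IH.
Qed.

End Scalar.

Section Pairs.
Variables (V W1 W2 : normedModType R) (U : set V).
Hypothesis Uopen : open U.

Lemma is_derive_pair (f : V -> W1) (g : V -> W2) x v df dg :
  is_derive x v f df -> is_derive x v g dg ->
  is_derive x v (fun y => (f y, g y)) (df, dg).
Proof.
move=> [fd fE] [gd gE].
have H : h^-1 *: ((f (h *: v + x), g (h *: v + x)) - (f x, g x))
    @[h --> (0 : R)^'] --> (df, dg).
  apply: cvg_pair => /=.
    by rewrite -fE; exact: fd.
  by rewrite -gE; exact: gd.
by split; [apply/cvg_ex; exists (df, dg)|exact/cvg_lim].
Qed.

Lemma Ck_pair k (f : V -> W1) (g : V -> W2) :
  Ck k U f -> Ck k U g -> Ck k U (fun x => (f x, g x)).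
Proof.
elim: k f g => [|k IH] f g Hf Hg.
  by move=> x Ux; apply: cvg_pair; [exact: Hf|exact: Hg].
apply: (@Ck_of_is_derive _ _ _ Uopen _ _ (fun v x => ('D_v f x, 'D_v g x))).
- move=> x Ux.
  by apply: cvg_pair; [exact: (Ck_continuous Hf)|exact: (Ck_continuous Hg)].
- move=> v x Ux; apply: is_derive_pair.
    exact: Ck_is_derive Hf Ux.
  exact: Ck_is_derive Hg Ux.
- by move=> v; apply: IH; exact: Ck_derive.
Qed.

End Pairs.

Lemma Ck_coord k n (U : set 'cV[R]_n) i : open U -> Ck k U (fun x : 'cV[R]_n => x i 0).
Proof.
move=> Uo; apply: Ck_linear => //; first exact: coord_continuous.
by move=> h v x; rewrite !mxE.
Qed.

Lemma Ck_dot k n (U : set 'cV[R]_n) a : open U -> Ck k U (fun x : 'cV[R]_n => dot a x).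
Proof.
move=> Uo; apply: Ck_bigsum => // i.
by apply: CkM => //; [exact: Ck_cst|exact: Ck_coord].
Qed.

End SmoothCalculus.

(** * Subgroups of the line and angles *)

Section Subgroups.
Variable R : realType.
Implicit Types (G : set R) (x y t T : R).

Definition real_subgroup G := G 0 /\ forall x y, G x -> G y -> G (x - y).

Lemma real_subgroup_mulz G x (k : int) : real_subgroup G -> G x -> G (x * k%:~R).
Proof.
move=> [G0 GB] Gx; have nat n : G (x * n%:R).
  elim: n => [|n IH]; first by rewrite mulr0.
  rewrite -natr1 mulrDr mulr1 -[x in _ + x]opprK -[X in G (_ - X)]sub0r.
  by apply: (GB) => //; exact: GB.
case: k => n; first exact: nat.
by rewrite NegzE mulrNz mulrN -sub0r; apply: (GB) => //; exact: nat.
Qed.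

Lemma euclidean_real (T x : R) : 0 < T ->
  exists k : int, 0 <= x - T * k%:~R < T.
Proof.
move=> T0; exists (Num.floor (x / T)).
have /andP[lo hi] := floor_itv (x / T); apply/andP; split.
  by rewrite subr_ge0 mulrC -ler_pdivlMr.
rewrite ltrBlDr -{1}(mulr1 T) -mulrDr mulrC -ltr_pdivrMr// addrC.
by rewrite intrD in hi.
Qed.

(** A nontrivial subgroup of the line without small positive elements has a least
    positive element, which generates it. *)
Lemma real_subgroup_dichotomy G : real_subgroup G ->
  (exists2 T, 0 <= T & forall x, G x <-> exists k : int, x = T * k%:~R) \/
  (forall e, 0 < e -> exists2 g, G g & 0 < g < e).
Proof.
move=> Gsub; have [G0 GB] := Gsub.
have [|/existsNP[e /not_implyP[e0 Ge]]] :=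
  pselect (forall e, 0 < e -> exists2 g, G g & 0 < g < e); first by right.
left; have sep g : G g -> 0 < g -> e <= g.
  move=> Gg g0; rewrite leNgt; apply/negP => ge; apply: Ge.
  by exists g; rewrite ?g0.
pose P := [set g | G g /\ 0 < g].
have [[g0 Pg0]|noP] := pselect (exists g, P g); last first.
  exists 0 => // x; split=> [Gx|[k ->]]; last by rewrite mul0r.
  exists 0; rewrite mul0r; have [x0|x0|//] := ltgtP x 0.
    case: noP; exists (- x); split; last by rewrite oppr_gt0.
    by rewrite -sub0r; exact: GB.
  by case: noP; exists x.
have Pinf : has_inf P.
  by split; [exists g0|exists e => g [Gg]; exact: sep].
pose m := inf P.
have m_le g : P g -> m <= g by apply: ge_inf; case: Pinf.
have [g Pg gm] := inf_adherent e0 Pinf.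
have gE : g = m.
  apply/eqP; rewrite eq_le (m_le _ Pg) andbT leNgt; apply/negP => mg.
  have gm0 : 0 < g - m by rewrite subr_gt0.
  have [h Ph hg] := inf_adherent gm0 Pinf.
  have hg' : h < g by move: hg; rewrite -/m addrC subrK.
  have : e <= g - h.
    by apply: sep; [apply: (GB); [case: Pg|case: Ph]|rewrite subr_gt0].
  by apply/negP; rewrite -ltNge; have := m_le _ Ph; rewrite -/m in gm *; lra.
have [Gm m0] : P m by rewrite -gE.
exists m; first exact: ltW.
move=> x; split=> [Gx|[k ->]]; last exact: real_subgroup_mulz.
have [k /andP[lo hi]] := euclidean_real x m0.
exists k; apply/eqP; rewrite -subr_eq0 eq_le lo andbT leNgt; apply/negP => r0.
have := m_le (x - m * k%:~R) (conj (GB _ _ Gx (real_subgroup_mulz k Gsub Gm)) r0).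
by rewrite leNgt hi.
Qed.

(** The multiples of a positive element smaller than e form a net of mesh e. *)
Lemma small_elements_dense G : real_subgroup G ->
  (forall e, 0 < e -> exists2 g, G g & 0 < g < e) ->
  forall x e, 0 < e -> exists2 g, G g & `|g - x| < e.
Proof.
move=> Gsub small x e e0; have [g Gg /andP[g0 ge]] := small e e0.
have [k /andP[lo hi]] := euclidean_real x g0.
exists (g * k%:~R); first exact: real_subgroup_mulz.
by rewrite distrC ger0_norm//; exact: lt_trans ge.
Qed.

End Subgroups.

Section Angles.
Variable R : realType.
Implicit Types (x y t a b c s : R).

Definition tau : R := pi *+ 2.

Lemma tau_gt0 : 0 < tau.
Proof. by rewrite mulrn_wgt0// pi_gt0. Qed.

Lemma cosDtau x (k : int) : cos (x + tau * k%:~R) = cos x.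
Proof.
have nat y n : cos (y + tau * n%:R) = cos y.
  by rewrite mulr_natr; exact: (periodicn (@cosD2pi R)).
case: k => n; first exact: nat.
by rewrite NegzE mulrNz mulrN -(nat _ n.+1) subrK.
Qed.

Lemma sinDtau x (k : int) : sin (x + tau * k%:~R) = sin x.
Proof.
have nat y n : sin (y + tau * n%:R) = sin y.
  by rewrite mulr_natr; exact: (periodicn (@sinD2pi R)).
case: k => n; first exact: nat.
by rewrite NegzE mulrNz mulrN -(nat _ n.+1) subrK.
Qed.

Lemma cos_eq1 x : cos x = 1 -> exists k : int, x = tau * k%:~R.
Proof.
have [k /andP[lo hi]] := euclidean_real x tau_gt0 => cx.
exists k; apply/eqP; rewrite -subr_eq0.
have : cos (x - tau * k%:~R) = 1 by rewrite -mulrN -mulrNz cosDtau.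
move: (x - _) lo hi => r lo hi cr.
have lt1 s : 0 < s -> s <= pi -> cos s < 1.
  move=> s0 spi; rewrite -cos0 ltr_cos// in_itv /= ?lexx ?pi_ge0// spi andbT.
  exact: ltW.
rewrite eq_le lo andbT leNgt; apply/negP => r0.
have [rpi|rpi] := leP r pi; first by have := lt1 _ r0 rpi; rewrite cr ltxx.
have [p1 p2] : 0 < tau - r /\ tau - r <= pi.
  by split; [rewrite subr_gt0|rewrite lerBlDr /tau mulr2n lerD2l ltW].
by have := lt1 _ p1 p2; rewrite addrC cosD2pi cosN cr ltxx.
Qed.

Lemma angle_exists x y : x ^+ 2 + y ^+ 2 = 1 ->
  exists t, x = cos t /\ y = sin t.
Proof.
move=> xy; have x1 : -1 <= x <= 1.
  by rewrite -ler_norml -(@expr_le1 _ 2)// real_normK ?num_real// -xy lerDl sqr_ge0.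
have cx : cos (acos x) = x by rewrite acosK// in_itv.
have sx : sin (acos x) = `|y|.
  by rewrite sin_acos// -xy addrC addKr sqrtr_sqr.
have [y0|y0] := ger0P y.
  by exists (acos x); rewrite cx sx ger0_norm.
by exists (- acos x); rewrite cosN sinN cx sx ltr0_norm// opprK.
Qed.

Lemma cos_sin_inj s t : cos s = cos t -> sin s = sin t ->
  exists k : int, s = t + tau * k%:~R.
Proof.
move=> cst sst; have [k kE] : exists k : int, s - t = tau * k%:~R.
  apply: cos_eq1; rewrite cosB cst sst -!expr2; exact: cos2Dsin2.
by exists k; rewrite -kE addrC subrK.
Qed.

(** Kronecker's theorem in dimension two: the flow with rates a and b on the
    torus is dense as soon as it is injective.  Prescribing the first angle
    leaves the second one free in a coset of the group generated by 2 pi and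
    2 pi b / a; a generator of this group would give a common period. *)
Lemma kronecker a b :
  (forall t, (exists m n : int, a * t = tau * m%:~R /\ b * t = tau * n%:~R) -> t = 0) ->
  forall x y e, 0 < e -> exists t (m n : int),
    a * t = x + tau * m%:~R /\ `|b * t - y - tau * n%:~R| < e.
Proof.
move=> indep x y e e0.
have t0 := tau_gt0.
have a0 : a != 0.
  apply/eqP => a0; have [b0|b0] := eqVneq b 0.
    have : (1 : R) = 0.
      by apply: indep; exists 0, 0; rewrite a0 b0 !mul0r mulr0.
    by apply/eqP; rewrite oner_eq0.
  have : tau / b = 0.
    by apply: indep; exists 0, 1; rewrite a0 mul0r mulr0 mulrCA divff.
  by apply/eqP; rewrite mulf_neq0// ?invr_eq0// gt_eqF.
pose G := [set g | exists m n : int, g = tau * (b / a) * m%:~R + tau * n%:~R].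
have Gsub : real_subgroup G.
  split; first by exists 0, 0; rewrite !mulr0 addr0.
  move=> _ _ [m [n ->]] [m' [n' ->]]; exists (m - m'), (n - n').
  by rewrite !rmorphB/=; ring.
have [[T T0 GT]|small] := real_subgroup_dichotomy Gsub.
  have /GT[k kE] : G tau by exists 0, 1; rewrite mulr0 add0r mulr1.
  have /GT[l lE] : G (tau * (b / a)) by exists 1, 0; rewrite mulr0 addr0 mulr1.
  have : tau * k%:~R / a = 0.
    apply: indep; exists k, l; split; first by rewrite mulrCA divff// mulr1.
    rewrite [LHS](_ : _ = tau * (b / a) * k%:~R); last by ring.
    by rewrite lE kE; ring.
  move=> /eqP; rewrite !mulf_eq0 invr_eq0 (negPf a0) orbF (gt_eqF t0)/=.
  by move=> /eqP k0; move: t0; rewrite kE k0 mulr0 ltxx.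
have [_ [m [n ->]] gd] := small_elements_dense Gsub small (y - b / a * x) e0.
exists ((x + tau * m%:~R) / a), m, (- n); split; first by rewrite mulrCA divff// mulr1.
rewrite rmorphN /=; apply: le_lt_trans gd; rewrite le_eqVlt; apply/orP; left.
by apply/eqP; congr `|_|; field.
Qed.

End Angles.

(** * Quotients of the line and the circle *)

Section Quotients.
Variable R : realType.
Implicit Types (S : set R) (s t T x y : R).

Lemma real_coset_eq S s t : real_subgroup S ->
  (real_coset S s = real_coset S t) <-> S (s - t).
Proof.
move=> [S0 SB]; have SN x : S x -> S (- x) by move=> Sx; rewrite -sub0r; exact: SB.
have sub u v : S (u - v) -> real_coset S u `<=` real_coset S v.
  move=> Suv _ [r Sr <-]; exists (u - v + r); last by rewrite addrA [v + _]addrC subrK.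
  by rewrite -[r]opprK; apply: (SB) => //; exact: SN.
split=> [E|Sst]; last first.
  by apply/seteqP; split; apply: sub => //; rewrite -opprB; exact: SN.
have : real_coset S s s by exists 0; rewrite ?addr0.
by rewrite E => -[r Sr <-]; rewrite addrC addKr.
Qed.

(** The value of f at an arbitrary representative of the coset C; the choice is
    immaterial when f is invariant under S. *)
Definition coset_map S (W : Type) (f : R -> W) (C : set R) : W :=
  f (xget 0 [set t | real_coset S t = C]).

Lemma coset_mapE S (W : Type) (f : R -> W) t : real_subgroup S ->
  (forall s t, S (s - t) -> f s = f t) -> coset_map S f (real_coset S t) = f t.
Proof.
move=> Ssub finv; rewrite /coset_map; case: xgetP => [s _ /= st|/(_ t)[]//].
by apply: finv; apply/(real_coset_eq _ _ Ssub).
Qed.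

Lemma quot_diffeomorphic_line S : real_subgroup S ->
  (forall t, S t -> t = 0) -> quot_diffeomorphic S [set: R].
Proof.
move=> Ssub S0; have FE t : coset_map S id (real_coset S t) = t.
  by apply: coset_mapE => // s r /S0/eqP; rewrite subr_eq0 => /eqP.
have Csmooth : Cinfty [set: R] (id : R -> R).
  by move=> k; apply: Ck_linear => //; [exact: openT|move=> x; exact: cvg_id].
exists (coset_map S id); split.
- split.
  + by move=> _ [t _ <-].
  + by move=> _ _ /set_mem[s _ <-] /set_mem[t _ <-]; rewrite !FE => ->.
  + by move=> t _; exists (real_coset S t).
- by rewrite /quot_smooth; under eq_fun do rewrite FE.
- by move=> b _; exists setT, id; split=> //; exact: openT.
Qed.

(** A continuous periodic function attains a maximum, so it is not onto the line. *)
Lemma not_quot_diffeomorphic_line S T : 0 < T -> S T -> real_subgroup S ->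
  ~ quot_diffeomorphic S [set: R].
Proof.
move=> T0 ST Ssub [F [[_ _ Fsurj] Fsmooth _]].
pose f t := F (real_coset S t).
have fcont : continuous f by move=> t; exact: (Ck_continuous (Fsmooth 0%N)).
have [c _ cmax] := EVT_max (ltW T0) (continuous_subspaceT fcont).
have [_ [t _ <-] tE] := Fsurj (f c + 1) I.
have [k /andP[lo hi]] := euclidean_real t T0.
have : f (t - T * k%:~R) <= f c by apply: cmax; rewrite in_itv /= lo ltW.
have -> : f (t - T * k%:~R) = f t.
  congr (F _); apply/real_coset_eq => //.
  by rewrite addrAC subrr add0r -mulrN -rmorphN; exact: real_subgroup_mulz.
by rewrite [f t]tE leNgt ltrDl ltr01.
Qed.

End Quotients.

Section Circle.
Variable R : realType.
Implicit Types (s t T x y : R).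

Definition vec2 x y : 'cV[R]_2 := \col_i (if i == 0 then x else y).

Definition circle_point t : 'cV[R]_2 := vec2 (cos t) (sin t).

Lemma vec2_0 x y : vec2 x y 0 0 = x.
Proof. by rewrite mxE. Qed.

Lemma vec2_1 x y : vec2 x y 1 0 = y.
Proof. by rewrite mxE. Qed.

Lemma vec2E (u : 'cV[R]_2) : u = vec2 (u 0 0) (u 1 0).
Proof.
apply/colP => i; rewrite mxE; case: ifP => [/eqP ->//|].
by case: i => -[|[|//]] // i1 _; congr (u _ _); exact/val_inj.
Qed.

Lemma dot2 (u v : 'cV[R]_2) : dot u v = u 0 0 * v 0 0 + u 1 0 * v 1 0.
Proof.
rewrite /dot big_ord_recl big_ord1; congr (_ + u _ _ * v _ _); exact/val_inj.
Qed.

Lemma circle_circle_point t : circle R (circle_point t).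
Proof. by rewrite /circle /= dot2 !(vec2_0, vec2_1) -!expr2 cos2Dsin2. Qed.

Lemma circleP (z : 'cV[R]_2) : circle R z -> exists t, z = circle_point t.
Proof.
rewrite /circle /= dot2 -!expr2 => /angle_exists[t [z0 z1]].
by exists t; rewrite [z]vec2E z0 z1.
Qed.

Lemma circle_pointDtau t (k : int) :
  circle_point (t + tau R * k%:~R) = circle_point t.
Proof. by rewrite /circle_point cosDtau sinDtau. Qed.

Lemma circle_point_inj s t : circle_point s = circle_point t ->
  exists k : int, s = t + tau R * k%:~R.
Proof.
move=> /colP E; apply: cos_sin_inj; first by have := E 0; rewrite !vec2_0.
by have := E 1; rewrite !vec2_1.
Qed.

Lemma Ck_circle_point (V : normedModType R) (U : set V) k (f : V -> R) : open U ->
  Ck k U f -> Ck k U (fun v => circle_point (f v)).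
Proof.
move=> Uo /(Ck_cos_sin Uo)[Hc Hs]; apply: Ck_col => // i.
by under eq_fun do rewrite mxE; case: (i == 0).
Qed.

(** Near the point of angle t0, the angle is t0 + atan (s / c), where (c, s) are
    the coordinates in the frame rotated by t0. *)
Lemma local_angle t0 : exists (U : set 'cV[R]_2) (theta : 'cV[R]_2 -> R),
  [/\ open U, U (circle_point t0), Cinfty U theta &
      forall z, circle R z -> U z -> circle_point (theta z) = z].
Proof.
pose b := circle_point t0; pose b' := vec2 (- sin t0) (cos t0).
pose U := [set z | 0 < dot b z].
have Uo : open U.
  apply: (@open_comp _ _ (fun z => dot b z) [set x | 0 < x]); last exact: open_gt.
  by move=> z _; exact: (Ck_continuous (Ck_dot 0 b openT)).
exists U, (fun z => t0 + atan (dot b' z / dot b z)); split => //.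
- by rewrite /U /= circle_circle_point.
- move=> k; apply: CkD => //; first exact: Ck_cst.
  apply: Ck_atan => //; apply: CkM => //; first exact: Ck_dot.
  by apply: Ck_inv => // [z /gt_eqF ->|]; last exact: Ck_dot.
- move=> z; rewrite /circle /U /= [dot z z]dot2 => z1 Uz.
  have cE : dot b z = cos t0 * z 0 0 + sin t0 * z 1 0.
    by rewrite dot2 vec2_0 vec2_1.
  have sE : dot b' z = - sin t0 * z 0 0 + cos t0 * z 1 0.
    by rewrite dot2 vec2_0 vec2_1.
  have t01 := cos2Dsin2 t0.
  have cs : dot b z ^+ 2 + dot b' z ^+ 2 = 1.
    rewrite cE sE [LHS](_ : _ = (cos t0 ^+ 2 + sin t0 ^+ 2) *
      (z 0 0 * z 0 0 + z 1 0 * z 1 0)); last by ring.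
    by rewrite t01 z1 mulr1.
  move: (dot b z) (dot b' z) cE sE cs Uz => c s cE sE cs c0.
  have c0' : c != 0 by rewrite gt_eqF.
  have catan : cos (atan (s / c)) = c.
    rewrite cos_atan (_ : 1 + _ = c ^- 2); last first.
      by rewrite -[1 in LHS](divff (_ : c ^+ 2 != 0)) ?sqrf_eq0// expr_div_n -mulrDl cs mul1r.
    by rewrite -exprVn sqrtr_sqr ger0_norm ?invr_ge0 ?(ltW c0)// invrK.
  have satan : sin (atan (s / c)) = s.
    have := atanK (s / c); rewrite /tan catan => /(congr1 ( *%R^~ c)).
    by rewrite !divfK.
  rewrite [RHS]vec2E /circle_point cosD sinD catan satan cE sE.
  congr vec2.
    transitivity ((cos t0 ^+ 2 + sin t0 ^+ 2) * z 0 0); first by ring.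
    by rewrite t01 mul1r.
  transitivity ((cos t0 ^+ 2 + sin t0 ^+ 2) * z 1 0); first by ring.
  by rewrite t01 mul1r.
Qed.

Lemma quot_diffeomorphic_circle (S : set R) T : 0 < T ->
  (forall t, S t <-> exists k : int, t = T * k%:~R) ->
  quot_diffeomorphic S (circle R).
Proof.
move=> T0 ST; have T0' : T != 0 by rewrite gt_eqF.
have tau0 : tau R != 0 by rewrite gt_eqF// tau_gt0.
have Ssub : real_subgroup S.
  split; first by apply/ST; exists 0; rewrite mulr0.
  move=> s t /ST[k ->] /ST[l ->]; apply/ST; exists (k - l).
  by rewrite rmorphB/= mulrBr.
pose f t := circle_point (tau R / T * t).
have finv s t : S (s - t) -> f s = f t.
  move=> /ST[k stk]; rewrite /f -[s](subrK t) stk mulrDr addrC.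
  by rewrite mulrA divfK// circle_pointDtau.
have FE t : coset_map S f (real_coset S t) = f t by exact: coset_mapE.
exists (coset_map S f); split.
- split.
  + by move=> _ [t _ <-]; rewrite FE; exact: circle_circle_point.
  + move=> _ _ /set_mem[s _ <-] /set_mem[t _ <-]; rewrite !FE => /circle_point_inj[k E].
    apply/real_coset_eq => //; apply/ST; exists k.
    have /(congr1 ( *%R (T / tau R))) := E.
    rewrite mulrDr !mulrA !divfK// mulfV// !mul1r => ->.
    by rewrite addrAC subrr add0r.
  + move=> z /circleP[t ->]; exists (real_coset S (T / tau R * t)) => //.
    rewrite FE /f mulrA mulrA divfK// mulfV// mul1r //.
- rewrite /quot_smooth; under eq_fun do rewrite FE.
  move=> k; apply: Ck_circle_point; first exact: openT.
  apply: Ck_linear; first exact: openT.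
    exact: mulrl_continuous.
  by move=> h v x; rewrite mulrDr mulrCA.
- move=> z /circleP[t ->]; have [U [theta [Uo Ut thetas thetaE]]] := local_angle t.
  exists U, (fun z => T / tau R * theta z); split => //.
    by move=> k; apply: CkM => //; exact: Ck_cst.
  move=> y cy Uy; rewrite FE /f mulrA mulrA divfK// mulfV// mul1r.
  exact: thetaE.
Qed.

End Circle.

(** * Orbits of three planar rotations with rates of sum zero *)

Section TorusOrbit.
Variables (R : realType) (n : nat).
Variables (p0 : 'cV[R]_n) (A B : 'I_3 -> 'cV[R]_n) (a : 'I_3 -> R).
Hypothesis a_sum : \sum_i a i = 0.
Hypothesis AA : forall i j, i != j -> dot (A i) (A j) = 0.
Hypothesis BB : forall i j, i != j -> dot (B i) (B j) = 0.
Hypothesis AB : forall i j, dot (A i) (B j) = 0.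
Hypothesis BBA : forall i, dot (B i) (B i) = dot (A i) (A i).
Hypothesis Ap0 : forall i, dot (A i) p0 = 0.
Hypothesis Bp0 : forall i, dot (B i) p0 = 0.

Definition torus_orbit (t : R) : 'cV[R]_n :=
  p0 + \sum_i (cos (a i * t) *: A i + sin (a i * t) *: B i).

Lemma dot_A (x y : 'I_3 -> R) i :
  dot (A i) (p0 + \sum_j (x j *: A j + y j *: B j)) = x i * dot (A i) (A i).
Proof.
rewrite dotDr Ap0 add0r dot_sumr (bigD1 i)//= big1 ?addr0 => [|j ji].
  by rewrite !dot_lin AB mulr0 addr0.
by rewrite !dot_lin AB mulr0 addr0 AA ?mulr0// eq_sym.
Qed.

Lemma dot_B (x y : 'I_3 -> R) i :
  dot (B i) (p0 + \sum_j (x j *: A j + y j *: B j)) = y i * dot (A i) (A i).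
Proof.
rewrite dotDr Bp0 add0r dot_sumr (bigD1 i)//= big1 ?addr0 => [|j ji].
  by rewrite !dot_lin (dotC (B i)) AB mulr0 add0r BBA.
by rewrite !dot_lin (dotC (B i)) AB mulr0 add0r BB ?mulr0// eq_sym.
Qed.

Lemma A_eq0 i : A i = 0 -> B i = 0.
Proof. by move=> Ai; apply: dot_eq0; rewrite BBA Ai dot0l. Qed.

Lemma dot_A_neq0 i : A i != 0 -> dot (A i) (A i) != 0.
Proof. by move=> /dot_gt0/gt_eqF ->. Qed.

Lemma torus_orbit_eq s t : torus_orbit s = torus_orbit t <->
  forall i, A i != 0 -> circle_point (a i * s) = circle_point (a i * t).
Proof.
split=> [E i Ai|H].
  have := congr1 (dot (A i)) E; rewrite !dot_A => /(mulIf (dot_A_neq0 Ai)) Ec.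
  have := congr1 (dot (B i)) E; rewrite !dot_B => /(mulIf (dot_A_neq0 Ai)) Es.
  by rewrite /circle_point Ec Es.
rewrite /torus_orbit; congr (_ + _); apply: eq_bigr => i _.
have [Ai|/H E] := eqVneq (A i) 0; first by rewrite (A_eq0 Ai) Ai !scaler0.
by rewrite -(vec2_0 (cos (a i * s)) (sin (a i * s))) -{2}(vec2_1 (cos (a i * s)) (sin (a i * s)))
  -!/(circle_point _) E vec2_0 vec2_1.
Qed.

Definition period : set R := [set t | torus_orbit t = torus_orbit 0].

Lemma periodP s t : torus_orbit s = torus_orbit t <-> period (s - t).
Proof.
have E i : circle_point (a i * (s - t)) = circle_point (a i * 0) <->
    circle_point (a i * s) = circle_point (a i * t).
  split=> /circle_point_inj[k].
    rewrite mulr0 add0r mulrBr => /eqP; rewrite subr_eq => /eqP ->.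
    by rewrite addrC circle_pointDtau.
  rewrite mulrBr => ->; rewrite addrAC subrr mulr0.
  exact: circle_pointDtau.
split=> [/torus_orbit_eq H|/torus_orbit_eq H]; apply/torus_orbit_eq => i Ai;
  by apply/E; exact: H.
Qed.

Lemma period_subgroup : real_subgroup period.
Proof.
by split=> // s t ps pt; apply: (periodP s t).1; rewrite ps pt.
Qed.

(** A rotating component bounds the positive periods from below. *)
Lemma period_cyclic : (exists i, A i != 0 /\ a i != 0) ->
  exists2 T, 0 <= T & forall t, period t <-> exists k : int, t = T * k%:~R.
Proof.
move=> [i [Ai ai]]; case: (real_subgroup_dichotomy period_subgroup) => // small.
have ai0 : 0 < `|a i| by rewrite normr_gt0.
have [g /torus_orbit_eq/(_ i Ai)] := small (tau R / `|a i|) (divr_gt0 (tau_gt0 R) ai0).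
move=> /circle_point_inj[k]; rewrite mulr0 add0r => aig /andP[g0].
rewrite ltr_pdivlMr// => gt.
have : `|a i * g| < tau R by rewrite normrM (gtr0_norm g0) mulrC.
rewrite aig normrM (gtr0_norm (tau_gt0 R)) -[X in _ < X]mulr1 ltr_pM2l ?tau_gt0//.
rewrite -intr_norm ltrz1 => k1; have k0 : k = 0 by move: k1; clear; case: k => [[|m]|m].
have : a i * g != 0 by rewrite mulf_neq0// gt_eqF.
by rewrite aig k0 mulr0 eqxx.
Qed.

Lemma ord3_cases (i j : 'I_3) : i != j -> exists k, [/\ k != i, k != j &
  forall (V : nmodType) (F : 'I_3 -> V), \sum_l F l = F i + F j + F k].
Proof.
have sum3 (V : nmodType) (F : 'I_3 -> V) : \sum_l F l = F 0 + F 1 + F 2%:R.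
  rewrite !big_ord_recr big_ord0 /= add0r.
  by congr (F _ + F _ + F _); exact/val_inj.
have all3 (P : 'I_3 -> Prop) : P 0 -> P 1 -> P 2%:R -> forall l, P l.
  move=> P0 P1 P2 [[|[|[|//]]] Hl].
  - by rewrite (_ : Ordinal _ = 0)//; exact/val_inj.
  - by rewrite (_ : Ordinal _ = 1)//; exact/val_inj.
  - by rewrite (_ : Ordinal _ = 2%:R)//; exact/val_inj.
move: i j; apply: (all3); apply: (all3) => //= _.
- by exists 2%:R; split=> // V F; rewrite sum3.
- by exists 1; split=> // V F; rewrite sum3 addrAC.
- by exists 2%:R; split=> // V F; rewrite sum3 (addrC (F 0)).
- by exists 0; split=> // V F; rewrite sum3 -addrA addrC.
- by exists 1; split=> // V F; rewrite sum3 addrAC (addrC (F 0)).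
- by exists 0; split=> // V F; rewrite sum3 -addrA addrC (addrC (F 1)).
Qed.

(** A single rotating plane would give a periodic orbit. *)
Lemma two_planes : (forall t, period t -> t = 0) ->
  exists i j, [/\ i != j, A i != 0 & A j != 0].
Proof.
move=> inj; apply: contrapT => H.
have [j Hj] : exists j, forall i, i != j -> A i = 0.
  have [[j Aj]|A0] := pselect (exists j, A j != 0); last first.
    by exists 0 => i _; apply/eqP; apply: contrapT => /negP Ai; apply: A0; exists i.
  exists j => i ij; apply/eqP; apply: contrapT => /negP Ai.
  by apply: H; exists i, j.
pose t : R := if a j == 0 then 1 else tau R / a j.
have t0 : t != 0.
  rewrite /t; case: ifPn => [_|aj]; first exact: oner_neq0.
  by rewrite mulf_neq0 ?invr_eq0// gt_eqF// tau_gt0.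
have : t = 0; last by move/eqP; rewrite (negPf t0).
apply: inj; apply/torus_orbit_eq => i Ai.
have [ij|/Hj Ai0] := eqVneq i j; last by rewrite Ai0 eqxx in Ai.
rewrite ij mulr0 /t; case: ifPn => [/eqP ->|aj]; first by rewrite mul0r.
by rewrite mulrCA divff// -(circle_pointDtau 0 1) add0r.
Qed.

Section Closure.
Hypothesis injective_orbit : forall t, period t -> t = 0.
Variables i j k : 'I_3.
Hypotheses (ij : i != j) (ki : k != i) (kj : k != j) (Ai : A i != 0) (Aj : A j != 0).
Hypothesis sum_ijk : forall (V : nmodType) (F : 'I_3 -> V),
  \sum_l F l = F i + F j + F k.

(** In complex notation p0 + z1 A_i + z2 A_j + conj (z1 z2) A_k, where the imaginary
    unit maps A to B. *)
Definition torus_param (z : 'cV[R]_2 * 'cV[R]_2) : 'cV[R]_n :=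
  let x1 := z.1 0 0 in let y1 := z.1 1 0 in
  let x2 := z.2 0 0 in let y2 := z.2 1 0 in
  p0 + (x1 *: A i + y1 *: B i + (x2 *: A j + y2 *: B j) +
    ((x1 * x2 - y1 * y2) *: A k + (- (x1 * y2 + y1 * x2)) *: B k)).

Definition torus_coord (x : 'cV[R]_n) : 'cV[R]_2 * 'cV[R]_2 :=
  (vec2 ((dot (A i) (A i))^-1 * dot (A i) x) ((dot (A i) (A i))^-1 * dot (B i) x),
   vec2 ((dot (A j) (A j))^-1 * dot (A j) x) ((dot (A j) (A j))^-1 * dot (B j) x)).

Lemma torus_coordK z : torus_coord (torus_param z) = z.
Proof.
case: z => z1 z2.
pose x l := if l == i then z1 0 0 else if l == j then z2 0 0 else
  z1 0 0 * z2 0 0 - z1 1 0 * z2 1 0.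
pose y l := if l == i then z1 1 0 else if l == j then z2 1 0 else
  - (z1 0 0 * z2 1 0 + z1 1 0 * z2 0 0).
have ji : j != i by rewrite eq_sym.
have -> : torus_param (z1, z2) = p0 + \sum_l (x l *: A l + y l *: B l).
  rewrite sum_ijk /x /y !eqxx (negPf ji) (negPf ki) (negPf kj) //.
rewrite /torus_coord !dot_A !dot_B /x /y !eqxx (negPf ji).
rewrite ![_^-1 * (_ * _)]mulrCA !mulVf ?dot_A_neq0// !mulr1.
by rewrite [z1 in RHS]vec2E [z2 in RHS]vec2E.
Qed.

(** The third rate is the opposite of the sum of the two others. *)
Lemma torus_orbitE t :
  torus_orbit t = torus_param (circle_point (a i * t), circle_point (a j * t)).
Proof.
have ak : a k = - (a i + a j).
  by have := a_sum; rewrite sum_ijk => /eqP; rewrite addr_eq0 => /eqP ->; rewrite opprK.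
rewrite /torus_orbit sum_ijk /torus_param !(vec2_0, vec2_1) ak mulNr cosN sinN mulrDl.
by rewrite cosD sinD [sin (a i * t) * _ + _]addrC.
Qed.

Lemma Cinfty_torus_coord (U : set 'cV[R]_n) : open U -> Cinfty U torus_coord.
Proof.
move=> Uo m; apply: Ck_pair => //; apply: Ck_col => // l;
  under eq_fun do rewrite mxE; case: (l == 0);
  by apply: CkM => //; [exact: Ck_cst|exact: Ck_dot].
Qed.

Lemma Cinfty_torus_param (U : set ('cV[R]_2 * 'cV[R]_2)) : open U -> Cinfty U torus_param.
Proof.
move=> Uo m.
have c1 l : Ck m U (fun z : 'cV[R]_2 * 'cV[R]_2 => z.1 l 0).
  apply: Ck_linear => //; last by move=> h v x; rewrite !mxE.
  move=> z; apply: (@continuous_comp _ _ _ fst (fun u : 'cV[R]_2 => u l 0)).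
    exact: cvg_fst.
  exact: coord_continuous.
have c2 l : Ck m U (fun z : 'cV[R]_2 * 'cV[R]_2 => z.2 l 0).
  apply: Ck_linear => //; last by move=> h v x; rewrite !mxE.
  move=> z; apply: (@continuous_comp _ _ _ snd (fun u : 'cV[R]_2 => u l 0)).
    exact: cvg_snd.
  exact: coord_continuous.
have cc (f : 'cV[R]_2 * 'cV[R]_2 -> R) c : Ck m U f -> Ck m U (fun z => f z * c).
  by move=> Hf; apply: CkM => //; exact: Ck_cst.
apply: Ck_col => // l; under eq_fun do rewrite !mxE.
repeat first [apply: cc | apply: CkD => // | apply: CkN => // | apply: CkM => // |
  exact: c1 | exact: c2 | exact: Ck_cst].
Qed.

Let torus : set ('cV[R]_2 * 'cV[R]_2) := circle R `*` circle R.

(** Closedness is read on equations: this set consists of the fixed points of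
    the composite of the two maps whose coordinates lie on the torus. *)
Lemma closed_torus_image : closed [set x | torus_param (torus_coord x) = x /\ torus (torus_coord x)].
Proof.
have cc : continuous torus_coord.
  by move=> x; exact: (Ck_continuous (Cinfty_torus_coord openT 0%N)).
have cp : continuous torus_param.
  by move=> x; exact: (Ck_continuous (Cinfty_torus_param openT 0%N)).
have cl (f g : 'cV[R]_n -> R) : continuous f -> continuous g ->
    closed [set x | f x = g x].
  move=> fc gc.
  rewrite (_ : [set x | _] = (fun x => f x - g x) @^-1` [set 0]); last first.
    by apply/seteqP; split => x /= /eqP; [rewrite -subr_eq0|rewrite subr_eq0] => /eqP.
  apply: preimage_closed => [x _|]; last exact: closed_eq.
  exact: (cvgB (fc x) (gc x)).
have cdot (h : 'cV[R]_n -> 'cV[R]_2) : continuous h -> closed [set x | dot (h x) (h x) = 1].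
  move=> hc; apply: (cl (fun x => dot (h x) (h x)) (fun=> 1)).
    by apply: continuous_dot => l; exact: continuous_entry.
  exact: cst_continuous.
rewrite (_ : [set x | _] = (\bigcap_(l in [set: 'I_n])
    [set x | torus_param (torus_coord x) l 0 = x l 0]) `&`
    ([set x | dot (torus_coord x).1 (torus_coord x).1 = 1] `&`
     [set x | dot (torus_coord x).2 (torus_coord x).2 = 1])); last first.
  apply/seteqP; split=> x /=.
    by move=> [E T]; split => // l _ /=; rewrite E.
  by move=> [E T]; split => //; apply/colP => l; exact: E.
apply: closedI; last apply: closedI.
- apply: closed_bigI => l _.
  apply: (cl (fun x => torus_param (torus_coord x) l 0) (fun x => x l 0)).
    apply: continuous_entry => x; apply: (@continuous_comp _ _ _ torus_coord torus_param).
      exact: cc.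
    exact: cp.
  exact: coord_continuous.
- apply: cdot => x; apply: (@continuous_comp _ _ _ torus_coord fst); first exact: cc.
  exact: cvg_fst.
- apply: cdot => x; apply: (@continuous_comp _ _ _ torus_coord snd); first exact: cc.
  exact: cvg_snd.
Qed.

(** The image of the torus is closed and contains the orbit; the orbit is dense in
    it by Kronecker's theorem, whose hypothesis on the rates amounts to the
    injectivity of the orbit. *)
Lemma closure_torus_orbit : closure (range torus_orbit) = torus_param @` torus.
Proof.
apply/seteqP; split.
  apply: (@subset_trans _ [set x | torus_param (torus_coord x) = x /\ torus (torus_coord x)]).
    rewrite [X in _ `<=` X](closure_id _).1; last exact: closed_torus_image.
    apply: closure_subset => _ [t _ <-] /=; rewrite torus_orbitE torus_coordK.
    by split=> //; split; exact: circle_circle_point.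
  by move=> x [xE Tx]; exists (torus_coord x).
move=> _ [[z1 z2] [/= /circleP[s1 ->] /circleP[s2 ->]] <-].
pose h (d : R) := torus_param (circle_point s1, circle_point (s2 + d)).
have hc : {for 0, continuous h}.
  have : Ck 0 setT (fun d : R => (circle_point s1, circle_point (s2 + d))).
    apply: Ck_pair; first exact: openT.
      by apply: Ck_cst; exact: openT.
    apply: Ck_circle_point; first exact: openT.
    by apply: CkD; [exact: openT|apply: Ck_cst; exact: openT|move=> x _; exact: cvg_id].
  move=> /(_ 0 I) cc; apply: (@continuous_comp _ _ _ _ torus_param) => //.
  exact: (Ck_continuous (Cinfty_torus_param openT 0%N)).
have h0 : h 0 = torus_param (circle_point s1, circle_point s2) by rewrite /h addr0.
move=> N; rewrite -h0 => /hc /nbhs_ballP[e /= e0 eN].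
have indep t : (exists m l : int, a i * t = tau R * m%:~R /\ a j * t = tau R * l%:~R) -> t = 0.
  move=> [m [l [mE lE]]]; apply: injective_orbit; rewrite /period /= !torus_orbitE mE lE.
  by rewrite !mulr0 -[tau R * m%:~R]add0r -[tau R * l%:~R]add0r !circle_pointDtau.
have [t [m [l [tm tl]]]] := kronecker indep s1 s2 e0.
exists (torus_orbit t); split; first by exists t.
have -> : torus_orbit t = h (a j * t - s2 - tau R * l%:~R).
  rewrite torus_orbitE tm circle_pointDtau /h; congr (torus_param (_, _)).
  rewrite -[RHS](circle_pointDtau _ l); congr circle_point.
  by ring.
by apply: eN; rewrite /ball /= sub0r normrN.
Qed.

Lemma diffeomorphic_closure :
  diffeomorphic (closure (range torus_orbit)) (circle R `*` circle R).
Proof.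
rewrite closure_torus_orbit; exists torus_coord, torus_param; split.
- move=> x _; exists setT, torus_coord; split=> //; first exact: openT.
  by apply: Cinfty_torus_coord; exact: openT.
- move=> z _; exists setT, torus_param; split=> //; first exact: openT.
  by apply: Cinfty_torus_param; exact: openT.
- by move=> _ [z Tz <-]; rewrite torus_coordK.
- by move=> z Tz; rewrite torus_coordK; split=> //; exists z.
Qed.

End Closure.
End TorusOrbit.

(** * The flow of an element of the Lie algebra of G_2 *)

Section Orbits.
Variables (R : realType) (xi : 'M[R]_7) (xi_g2 : g2 R xi).
Implicit Types p : 'cV[R]_7.

Lemma fundvf_tangent p : dot p (fundvf xi p) = 0.
Proof.
have := dot_skew (g2_skew xi_g2) p p; rewrite fundvfE (dotC _ p); lra.
Qed.

Lemma flow_S6 p t : S6 R p -> S6 R (flow xi p t).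
Proof.
move=> pS; rewrite /S6 /=.
rewrite (skew_dot_const (g2_skew xi_g2) (solves_flow xi p) (solves_flow xi p) t 0).
by rewrite !flow0.
Qed.

Lemma fundvf_flow p t : fundvf xi (flow xi p t) = 'D_1 (flow xi p) t.
Proof. by rewrite fundvfE flow_derivative. Qed.

(** The velocity xi x(t) satisfies the same equation as x(t), so its norm is
    constant. *)
Lemma fundvf_flow_neq0 p t : fundvf xi p != 0 -> fundvf xi (flow xi p t) != 0.
Proof.
rewrite !fundvfE => /dot_gt0 p0.
have sol : solves xi (fun t => xi *m flow xi p t).
  by apply: solves_mulmx => //; exact: solves_flow.
apply: contraTneq p0 => ft0.
have := skew_dot_const (g2_skew xi_g2) sol sol t 0.
by rewrite flow0 ft0 dot0l => <-; rewrite ltxx.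
Qed.

Lemma flow_fixed p : fundvf xi p = 0 -> forall t, flow xi p t = p.
Proof.
rewrite fundvfE => p0 t.
have sol : solves xi (fun=> p) by move=> s; rewrite p0; exact: is_derive_cst.
by rewrite (skew_solves_unique (g2_skew xi_g2) (solves_flow xi p) sol (flow0 xi p)).
Qed.

(** By uniqueness of solutions, it is enough to differentiate the right-hand side:
    xi maps A_i to a_i (e x A_i) and e x A_i to - a_i A_i. *)
Lemma flow_torus_orbit p : exists p0 (A B : 'I_3 -> 'cV[R]_7) (a : 'I_3 -> R),
  [/\ \sum_i a i = 0,
      (forall i j, i != j -> dot (A i) (A j) = 0) /\
      (forall i j, i != j -> dot (B i) (B j) = 0),
      (forall i j, dot (A i) (B j) = 0) /\
      (forall i, dot (B i) (B i) = dot (A i) (A i)),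
      (forall i, dot (A i) p0 = 0) /\ (forall i, dot (B i) p0 = 0) &
      flow xi p = torus_orbit p0 A B a].
Proof.
have skew := g2_skew xi_g2.
have [e [A [a [c [[e1 xie] a0 AE AA ->]]]]] :=
  orbit_decomposition skew (g2_derivation xi_g2) p.
pose B i := cross e (A i).
have eA i : dot e (A i) = 0 by case: (AE i).
have BA i j : dot (B i) (A j) = 0.
  have [->|/AA[]//] := eqVneq i j.
  by rewrite /B dotC dot_crossr.
exists (c *: e), A, B, a; split => //.
- split=> i j ij; first by case: (AA i j ij).
  by rewrite dot_cross_cross//; case: (AA i j ij).
- split=> [i j|i]; first by rewrite dotC.
  by rewrite dot_cross_cross.
- split=> i; rewrite dotZr dotC ?eA ?dot_crossl mulr0 //.
apply: (skew_solves_unique skew (solves_flow xi _)).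
  move=> t; apply/is_derive_colP => l.
  have -> : xi *m torus_orbit (c *: e) A B a t =
      \sum_i (- (sin (a i * t) * a i) *: A i + (cos (a i * t) * a i) *: B i).
    rewrite /torus_orbit mulmxDr -scalemxAr xie scaler0 add0r mulmx_sumr.
    apply: eq_bigr => i _; have [_ AiE] := AE i.
    rewrite mulmxDr -!scalemxAr (xi_crosse (g2_derivation xi_g2) xie) AiE crossZr.
    by rewrite (crosse_crosse e1 (eA i)) !scalerN !scalerA [LHS]addrC scaleNr.
  rewrite summxE; under eq_fun do rewrite mxE summxE.
  rewrite -[X in is_derive _ _ _ X]add0r.
  apply: (is_deriveD (is_derive_cst ((c *: e) l 0) t (1 : R))).
  apply: is_derive_bigsum => i.
  have lin : is_derive t (1 : R) (fun s : R => a i * s) (a i).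
    by rewrite -[X in is_derive _ _ _ X]mulr1; exact: (is_deriveZ (a i) (is_derive_id t 1)).
  have dc := is_derive_outer lin (is_derive_cos (a i * t)).
  have ds := is_derive_outer lin (is_derive_sin (a i * t)).
  have E s : (cos (a i * s) *: A i + sin (a i * s) *: B i) l 0 =
      A i l 0 * cos (a i * s) + B i l 0 * sin (a i * s).
    by rewrite !mxE; ring.
  under eq_fun do rewrite E.
  rewrite [X in is_derive _ _ _ X](_ : _ =
      A i l 0 * (- sin (a i * t) * a i) + B i l 0 * (cos (a i * t) * a i)).
    exact: (is_deriveD (is_deriveZ (A i l 0) dc) (is_deriveZ (B i l 0) ds)).
  by rewrite !mxE; ring.
rewrite flow0 /torus_orbit; congr (_ + _); apply: eq_bigr => i _.
by rewrite mulr0 cos0 sin0 scale1r scale0r addr0.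
Qed.

Lemma smooth_torus_orbit n (q : 'cV[R]_n) (A B : 'I_3 -> 'cV[R]_n) a :
  Cinfty [set: R] (torus_orbit q A B a).
Proof.
move=> k; apply: Ck_col; first exact: openT.
move=> l; under eq_fun do rewrite mxE summxE.
apply: CkD; [exact: openT|by apply: Ck_cst; exact: openT|].
apply: Ck_bigsum; first exact: openT.
move=> i; under eq_fun do rewrite !mxE.
have lin : Ck k [set: R] (fun t : R => a i * t).
  apply: Ck_linear; first exact: openT.
    exact: mulrl_continuous.
  by move=> h v x; rewrite mulrDr mulrCA.
have [Hc Hs] := Ck_cos_sin openT lin.
by apply: CkD; [exact: openT|..]; (apply: CkM; [exact: openT|by []|]);
  apply: Ck_cst; exact: openT.
Qed.

Lemma flow_smooth p : Cinfty [set: R] (flow xi p).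
Proof.
have [p0 [A [B [a [_ _ _ _ ->]]]]] := flow_torus_orbit p.
exact: smooth_torus_orbit.
Qed.

End Orbits.

Theorem proposition4p5 (R : realType) (xi : 'M[R]_7)
    (H : 'cV[R]_7 -> 'cV[R]_7 -> R)
    (xi_g2 : g2 R xi) (H_form : one_form H) (H_HDW : HDW H (fundvf xi)) :
  [/\ (forall p, S6 R p -> dynamical_HDW H (flow xi p)),
      (forall psi : R -> 'cV[R]_7, dynamical_HDW H psi ->
         exists gamma : R -> 'cV[R]_7,
           integral_curve (fundvf xi) gamma /\ range psi = range gamma),
      (forall p, S6 R p -> fundvf xi p = 0 -> range (flow xi p) = [set p]) &
      (forall p, S6 R p -> fundvf xi p <> 0 ->
         [/\ (exists F : set R -> 'cV[R]_7,
                (forall t, F (real_coset (stab xi p) t) = flow xi p t) /\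
                quot_injective_immersion (stab xi p) F),
             quot_diffeomorphic (stab xi p) (circle R) \/
             quot_diffeomorphic (stab xi p) [set: R] &
             quot_diffeomorphic (stab xi p) [set: R] ->
             diffeomorphic (closure (range (flow xi p)))
                           (circle R `*` circle R)])].
Proof.
split.
- move=> p pS; split; first by split=> [|t]; [exact: flow_smooth|exact: flow_S6].
  by move=> t; rewrite -fundvf_flow; apply: H_HDW; exact: flow_S6.
- move=> psi [[psi_smooth psiS] psiH]; exists psi; split=> //; split=> // t.
  have dpsi : is_derive t (1 : R) psi ('D_1 psi t).
    exact: (Ck_is_derive (1 : R) (psi_smooth 1%N)).
  have psiT : dot (psi t) ('D_1 psi t) = 0.
    have := is_derive_dot dpsi dpsi; under eq_fun do rewrite psiS.
    move=> /(is_derive_unique (is_derive_cst (1 : R) t 1)).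
    rewrite (dotC ('D_1 psi t)); lra.
  (* both vectors are tangent at psi t and have the same contraction with omega *)
  apply/eqP; rewrite -subr_eq0; apply/eqP.
  apply: (cross_nondegenerate (p := psi t)).
    by rewrite dotDr dotNr psiT fundvf_tangent// subrr.
  move=> v w pv pw; rewrite -scaleN1r crossDl crossZl scaleN1r dotDl dotNl.
  apply/eqP; rewrite subr_eq0; apply/eqP.
  exact: (etrans (psiH t v w pv pw) (esym (H_HDW _ (psiS t) v w pv pw))).
- move=> p pS /(flow_fixed xi_g2) fixed; apply/seteqP; split.
    by move=> _ [t _ <-] /=; exact: fixed.
  by move=> _ ->; exists 0 => //; exact: fixed.
move=> p pS /eqP p0.
have p0t t := fundvf_flow_neq0 xi_g2 t p0.
have smooth := flow_smooth xi_g2 p.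
have [q [A [B [a [a_sum [AA BB] [AB BBA] [Aq Bq] flowE]]]]] := flow_torus_orbit xi_g2 p.
have stabE : stab xi p = period q A B a.
  by rewrite /stab /period -flowE flow0.
have moving : exists i, A i != 0 /\ a i != 0.
  apply: contrapT => static.
  have := p0; rewrite /fundvf flowE (_ : torus_orbit _ _ _ _ = cst (torus_orbit q A B a 0)).
    by rewrite derive_cst eqxx.
  apply/funext => t; apply/(torus_orbit_eq a AA BB AB BBA Aq Bq) => i Ai.
  have -> : a i = 0 by apply/eqP; apply: contrapT => /negP ai; apply: static; exists i.
  by rewrite !mul0r.
have per s t : flow xi p s = flow xi p t <-> stab xi p (s - t).
  by rewrite stabE flowE; exact: periodP.
have Ssub : real_subgroup (stab xi p) by rewrite stabE; exact: period_subgroup.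
have FE t : coset_map (stab xi p) (flow xi p) (real_coset (stab xi p) t) = flow xi p t.
  by apply: coset_mapE; [exact: Ssub|move=> s r /per].
have [T T0 ST] := period_cyclic AA BB AB BBA Aq Bq moving.
rewrite -stabE in ST.
split.
- exists (coset_map (stab xi p) (flow xi p)); split; first exact: FE.
  split.
  + by rewrite /quot_smooth; under eq_fun do rewrite FE.
  + move=> _ _ /set_mem[s _ <-] /set_mem[t _ <-]; rewrite !FE => /per.
    by move/real_coset_eq; apply.
  + move=> t.
    rewrite (_ : (fun s => _) = flow xi p); last by apply/funext => s; exact: FE.
    by have := p0t t; rewrite (fundvf_flow xi p t).
- move: T0; rewrite le_eqVlt => /orP[/eqP T0|T0].
    right; apply: quot_diffeomorphic_line => // t /ST[k ->].
    by rewrite -T0 mul0r.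
  by left; exact: quot_diffeomorphic_circle ST.
- move=> line; have T_eq0 : T = 0.
    apply/eqP; rewrite eq_le T0 andbT leNgt; apply/negP => Tpos.
    apply: (not_quot_diffeomorphic_line Tpos _ Ssub line).
    by apply/ST; exists 1; rewrite mulr1.
  have inj t : period q A B a t -> t = 0.
    by rewrite -stabE => /ST[k ->]; rewrite T_eq0 mul0r.
  have [i [j [ij Ai Aj]]] := two_planes AA BB AB BBA Aq Bq inj.
  have [k [ki kj sum_ijk]] := ord3_cases ij.
  rewrite flowE; exact: (@diffeomorphic_closure _ _ _ _ _ _ _ _ _ _ _ _ _ inj i j k).
Qed.
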